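(* For every integer $m\ge 1$, \begin{align*} S(2, \{1\}_{2m-2}, \overline{1}) = {} & - m \big( 2^{-2m+1} - 4 \big) \zeta(2m+1) - 2 (1 - 2^{-2m}) \log(2)\, \zeta(2m) - \pi \beta(2m) \\ & - \sum_{\substack{a+b = m \\ a, b \geq 1}} 2(1 - 2^{-2a})\big( 4^{-2b} - 3 \cdot 2^{-2b} + 2 \big) \zeta(2a) \zeta(2b+1), \end{align*} and $$T(2, \{1\}_{2m-1}, \overline{1}) = -2(2m+1)\beta(2m+2) + \sum_{\substack{a + b = m+1 \\ a, b \geq 1}} 4 (1 - 2^{-2a}) \zeta(2a) \beta(2b) .$$
   Context: $\zeta$ is the Riemann zeta function and $\beta(s)=\sum_{n\ge1}(-1)^{n-1}(2n-1)^{-s}$ is the Dirichlet beta function. $\{1\}_n$ denotes $1$ repeated $n$ times. The values in question are the (convergent) multiple $S$ and $T$ values $$S(2,\{1\}_{2m-2},\overline1)=2^{2m}\sum_{\substack{n_1>n_2>\cdots>n_{2m}>0\\ n_1,n_3,\ldots,n_{2m-1}\text{ odd}\\ n_2,n_4,\ldots,n_{2m}\text{ even}}}\frac{(-1)^{n_{2m}/2}}{n_1^2n_2\cdots n_{2m}},$$ $$T(2,\{1\}_{2m-1},\overline1)=-2^{2m+1}\sum_{\substack{n_1>n_2>\cdots>n_{2m+1}>0\\ n_1,n_3,\ldots,n_{2m+1}\text{ odd}\\ n_2,n_4,\ldots,n_{2m}\text{ even}}}\frac{(-1)^{(n_{2m+1}-1)/2}}{n_1^2n_2\cdots n_{2m+1}}.$$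 *)

(* Defs.v *)
From mathcomp Require Import all_boot all_order all_algebra.
From mathcomp Require Import all_classical all_reals all_analysis.

Set Implicit Arguments.
Unset Strict Implicit.
Unset Printing Implicit Defensive.

Import Order.TTheory GRing.Theory Num.Theory.
Import numFieldNormedType.Exports.

Local Open Scope classical_set_scope.
Local Open Scope ring_scope.

(* Only the values at integers s >= 2 are used, where the Dirichlet series
   converges and is the definition of zeta. *)
Definition riemann_zeta (R : realType) (s : nat) : R :=
  limn (fun N => \sum_(1 <= n < N) (n%:R ^- s : R)).

Definition dirichlet_beta (R : realType) (s : nat) : R :=
  limn (fun N => \sum_(1 <= n < N)
    ((-1) ^+ (n - 1)%N * (2 * n - 1)%N%:R ^- s : R)).

(* The indices are shifted: n i stands for n_{i+1}, so n_1, n_3, ... are the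
   values of n at 0, 2, ..., with n_1 = n ord0 and n_{d+1} = n ord_max. *)
Definition alternating_index (d N : nat) (n : {ffun 'I_d.+1 -> 'I_N}) : bool :=
  [&& [forall i, (0 < n i)%N],
      [forall i : 'I_d.+1, forall j : 'I_d.+1, (i < j)%N ==> (n j < n i)%N]
    & [forall i : 'I_d.+1, odd (n i) == ~~ odd i]].

Definition index_weight (R : realType) (d N : nat)
    (n : {ffun 'I_d.+1 -> 'I_N}) : R :=
  (n ord0)%:R ^+ 2 * \prod_(i < d.+1 | i != ord0) (n i)%:R.

(* The part of the series of S(2, {1}_{2m-2}, \bar 1) with n_1 < N; the depth
   2m is written (2m-1)+1, which is correct for m >= 1. *)
Definition multS_partial (R : realType) (m N : nat) : R :=
  2 ^+ (2 * m) *
  \sum_(n : {ffun 'I_(2 * m).-1.+1 -> 'I_N} | alternating_index n)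
     (-1) ^+ (n ord_max %/ 2) / index_weight R n.

(* The part of the series of T(2, {1}_{2m-1}, \bar 1) with n_1 < N. *)
Definition multT_partial (R : realType) (m N : nat) : R :=
  - 2 ^+ (2 * m + 1) *
  \sum_(n : {ffun 'I_(2 * m).+1 -> 'I_N} | alternating_index n)
     (-1) ^+ ((n ord_max - 1) %/ 2) / index_weight R n.

Definition multS (R : realType) (m : nat) : R := limn (multS_partial R m).

Definition multT (R : realType) (m : nat) : R := limn (multT_partial R m).

(* Main.v *)
Require Import Defs.
From mathcomp Require Import all_boot all_order all_algebra.
From mathcomp Require Import all_classical all_reals all_analysis.
From mathcomp Require Import ring lra zify.

(** Write q = (1-t)/(1+t), an involution of [0, 1], and put
    D_p = \int_0^1 q^p/(1+t^2) dt and A_p = \int_0^1 q^p/(1+t) dt; these are the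
    tails of the alternating series for pi/4 and ln 2.

    Reduction to single series.  Both multiple values have the form
    \sum_n c_d(n)/n up to sign and a power of 2, where c_0(k) = a_k/k and
    c_(j+1)(n) = (1/n) \sum c_j(k) over the k < n of parity opposite to n
    ([multT_partialE], [multS_partialE]).  The connector
    C(n,p) = n \int_0^1 t^(n-1) q^p dt satisfies, by two integrations by parts,
      \sum_(n > k, n - k odd) C(n,p)/n = C(k,p)/(2p)    and
      1/n = \sum_(p odd) (2/p) C(n,p),
    so that the d steps of the chain are traded for a factor (2p)^-d
    ([chain_duality]):
      \sum_n c_d(n)/n = \sum_(p odd) (2/p) (2p)^-d \sum_k (a_k/k) C(k,p).
    The inner sum is geometric under the integral, and the T and S values become
    -4 \sum_(p odd) p^(-2m-1) D_p and -4 \sum_(p odd) p^(-2m) (A_p - D_(p+1)).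

    Evaluation of the single series.  The products of zeta and beta values on the
    right-hand side are the double series
    \sum_(p odd) \sum_n g(n) \sum_(a+b=M) p^(-2a) n^(-2b), with g the nontrivial
    character chi modulo 4 for T, and g(n) = per4(n)/n for S, where per4 is the
    sequence of period 4 with values 0, 2, -4, 2.  Partial fractions split the
    summand into a part with 1/(n^2-p^2) times p^(-2M+2), a part with 1/(n^2-p^2)
    times n^(-2M+2), and a diagonal part ([parity_sum]).  Summing the second over
    p and then n gives a rational multiple of a zeta or beta value.  Summing the
    first over n requires the sums of chi(n)/(n+x) and per4(n)/(n+x) for x = p and
    x = -p.  They are D_x and 2 (A_x - D_(x+1)), for the extensions of D and A to all
    integers that satisfy the same recurrences, with the convention 1/0 = 0 removing
    the pole ([chi_sum_cvg], [per4_sum_cvg]); so they are again D_p and A_p - D_(p+1)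
    up to elementary terms.  Limits and infinite sums are exchanged by dominated
    convergence for series ([tannery]). *)

Import Order.TTheory GRing.Theory Num.Theory.
Import numFieldNormedType.Exports.

Set Implicit Arguments.
Unset Strict Implicit.
Unset Printing Implicit Defensive.

Local Open Scope classical_set_scope.
Local Open Scope ring_scope.

(** * Integrals of continuous functions over [0, 1] *)

Section unit_integral.
Context {R : realType}.
Implicit Types (f g F : R -> R) (a b x t : R) (n p : nat).

(** Continuity, as a function on the whole line, at every point of [0, 1]; this is
    stronger than continuity within [0, 1] and is stable under field operations. *)
Definition ucont f := forall x, 0 <= x <= 1 -> {for x, continuous f}.

(** The Lebesgue integral of [f] over [0, 1]. *)
Definition uint f : R := \int[lebesgue_measure]_(x in `[0, 1]) f x.

Lemma ucont_cst a : ucont (fun=> a).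
Proof. by move=> x _; exact: cvg_cst. Qed.

Lemma ucont_id : ucont id.
Proof. by move=> x _; exact: cvg_id. Qed.

Lemma ucontD f g : ucont f -> ucont g -> ucont (fun x => f x + g x).
Proof. by move=> hf hg x x01; apply: continuousD; [exact: hf|exact: hg]. Qed.

Lemma ucontM f g : ucont f -> ucont g -> ucont (fun x => f x * g x).
Proof. by move=> hf hg x x01; apply: continuousM; [exact: hf|exact: hg]. Qed.

Lemma ucontX f n : ucont f -> ucont (fun x => f x ^+ n).
Proof.
move=> hf; elim: n => [|n IH].
  by under eq_fun do rewrite expr0; exact: ucont_cst.
by under eq_fun do rewrite exprS; exact: ucontM.
Qed.

Lemma ucontV f : (forall x, 0 <= x <= 1 -> f x != 0) -> ucont f ->
  ucont (fun x => (f x)^-1).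
Proof. by move=> f0 hf x x01; apply: continuousV; [exact: f0|exact: hf]. Qed.

Lemma ucont_within f : ucont f -> {within `[0, 1], continuous f}.
Proof.
move=> hf; apply: continuous_in_subspaceT => x.
by rewrite inE/= in_itv/= => /hf.
Qed.

Lemma ucont_integrable f : ucont f ->
  lebesgue_measure.-integrable `[0, 1] (EFin \o f).
Proof.
move=> /ucont_within hf; apply: continuous_compact_integrable => //.
exact: segment_compact.
Qed.

Lemma eq_uint f g : (forall x, 0 <= x <= 1 -> f x = g x) -> uint f = uint g.
Proof.
by move=> fg; apply: eq_Rintegral => x; rewrite inE/= in_itv/= => /fg.
Qed.

Lemma uint_le f g : ucont f -> ucont g ->
  (forall x, 0 <= x <= 1 -> f x <= g x) -> uint f <= uint g.
Proof.
move=> hf hg fg; exact: le_Rintegral (ucont_integrable hf) (ucont_integrable hg) _.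
Qed.

Lemma uint_ge0 f : (forall x, 0 <= x <= 1 -> 0 <= f x) -> 0 <= uint f.
Proof.
by move=> f0; apply: Rintegral_ge0 => x /=; rewrite in_itv/= => /f0.
Qed.

Lemma uintD f g : ucont f -> ucont g ->
  uint (fun x => f x + g x) = uint f + uint g.
Proof. by move=> hf hg; exact: RintegralD (ucont_integrable hf) (ucont_integrable hg). Qed.

Lemma uintB f g : ucont f -> ucont g ->
  uint (fun x => f x - g x) = uint f - uint g.
Proof. by move=> hf hg; exact: RintegralB (ucont_integrable hf) (ucont_integrable hg). Qed.

Lemma uintZ a f : ucont f -> uint (fun x => a * f x) = a * uint f.
Proof. by move=> hf; exact: RintegralZl (ucont_integrable hf). Qed.

Lemma uint_sum (I : Type) (s : seq I) (h : I -> R -> R) :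
  (forall i, ucont (h i)) ->
  uint (fun x => \sum_(i <- s) h i x) = \sum_(i <- s) uint (h i).
Proof.
move=> hh; elim: s => [|i s IH].
  under eq_fun do rewrite big_nil.
  by rewrite big_nil /uint Rintegral_cst// mul0r.
rewrite big_cons -IH -uintD//; first by under eq_fun do rewrite big_cons.
elim: s {IH} => [|j s IH].
  by under eq_fun do rewrite big_nil; exact: ucont_cst.
by under eq_fun do rewrite big_cons; exact: ucontD.
Qed.

(** [F] is a primitive of [f] on [0, 1], with two-sided derivatives at 0 and 1. *)
Definition uprimitive F f := forall x, 0 <= x <= 1 -> is_derive x 1 F (f x).

Lemma uint_FTC f F : uprimitive F f ->
  ucont f -> uint f = F 1 - F 0.
Proof.
move=> dF hf.
have cF x : 0 <= x <= 1 -> F @ x --> F x.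
  move=> /dF xF; apply/differentiable_continuous/derivable1_diffP.
  exact: ex_derive.
rewrite /uint /Rintegral (@continuous_FTC2 _ f F)//.
- exact: ucont_within.
- split.
  + move=> x; rewrite in_itv/= => /andP[x0 x1].
    have := dF x; rewrite (ltW x0) (ltW x1) => /(_ isT) ?; exact: ex_derive.
  + by apply: cvg_at_right_filter; apply: cF; rewrite lexx ler01.
  + by apply: cvg_at_left_filter; apply: cF; rewrite lexx ler01.
- move=> x; rewrite in_itv/= => /andP[x0 x1]; rewrite derive1E.
  by have := dF x; rewrite (ltW x0) (ltW x1) => /(_ isT) ?; exact: derive_val.
Qed.

(** The involution t |-> (1-t)/(1+t) of [0, 1], written q in the comments. *)
Definition cay x : R := (1 - x) / (1 + x).

Lemma is_derive_cay x : 0 <= x -> is_derive x 1 cay (- (2 / (1 + x) ^+ 2)).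
Proof.
move=> x0; have xn0 : 1 + x != 0 by rewrite gt_eqF// ltr_pwDl.
have h1 : is_derive x 1 (fun y : R => 1 - y) (-1).
  apply: is_derive_eq (is_deriveB (is_derive_cst (1 : R) x 1) (is_derive_id x 1)) _.
  by rewrite sub0r.
have h2 : is_derive x 1 (fun y : R => 1 + y) 1.
  apply: is_derive_eq (is_deriveD (is_derive_cst (1 : R) x 1) (is_derive_id x 1)) _.
  by rewrite add0r.
have h3 := is_deriveV xn0 h2.
have h4 := is_deriveM h1 h3.
apply: is_derive_eq h4 _; rewrite /GRing.scale/=.
by field.
Qed.

Lemma ucont_cay : ucont cay.
Proof.
apply: ucontM.
  by move=> x _; apply: continuousB; [exact: cvg_cst|exact: cvg_id].
apply: ucontV; last by apply: ucontD; [exact: ucont_cst|exact: ucont_id].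
by move=> x /andP[x0 _]; rewrite gt_eqF// ltr_pwDl.
Qed.

Lemma cay_ge0 x : 0 <= x <= 1 -> 0 <= cay x.
Proof. by move=> /andP[x0 x1]; rewrite divr_ge0 ?subr_ge0// addr_ge0. Qed.

Lemma cay_le x : 0 <= x <= 1 -> cay x <= 1 - x.
Proof.
move=> /andP[x0 x1]; rewrite ler_pdivrMr ?ltr_pwDl//.
by rewrite ler_peMr ?subr_ge0// lerDl.
Qed.

Lemma cay_le1 x : 0 <= x <= 1 -> cay x <= 1.
Proof. by move=> x01; rewrite (le_trans (cay_le x01))// gerBl; case/andP: x01. Qed.

Lemma is_derive_mono n x : is_derive x 1 (fun y : R => y ^+ n) (n%:R * x ^+ n.-1).
Proof.
have := @is_deriveX R R (@id R) n x 1 1 (is_derive_id _ _).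
rewrite /GRing.scale/= mulr1.
rewrite (_ : (fun y : R => y ^+ n) = (@id R) ^+ n)//.
by apply/funext => y; rewrite fctE.
Qed.

Lemma is_derive_cayX p x : 0 <= x ->
  is_derive x 1 (fun y => cay y ^+ p) (- (p%:R * cay x ^+ p.-1 * (2 / (1 + x) ^+ 2))).
Proof.
move=> /is_derive_cay h; have h1 := is_deriveX p h.
rewrite (_ : (fun y => cay y ^+ p) = cay ^+ p).
  by apply: is_derive_eq; rewrite /GRing.scale/= mulrN.
by apply/funext => y; rewrite fctE.
Qed.

End unit_integral.

(** * The integrals J, D and A *)

Section beta_integrals.
Context {R : realType}.
Implicit Types (n p : nat).

(** \int_0^1 t^n q^p dt. *)
Definition Jint n p : R := uint (fun t => t ^+ n * cay t ^+ p).
(** \int_0^1 q^p/(1+t^2) dt, the tail 1/(p+1) - 1/(p+3) + 1/(p+5) - ... *)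
Definition Dint p : R := uint (fun t => cay t ^+ p / (1 + t ^+ 2)).
(** \int_0^1 q^p/(1+t) dt, the tail 1/(p+1) - 1/(p+2) + 1/(p+3) - ... *)
Definition Aint p : R := uint (fun t => cay t ^+ p / (1 + t)).

Lemma onepX2_neq0 (t : R) : 1 + t ^+ 2 != 0.
Proof. by rewrite gt_eqF// ltr_pwDl// sqr_ge0. Qed.

Lemma onep_neq0 (t : R) : 0 <= t <= 1 -> 1 + t != 0.
Proof. by move=> /andP[t0 _]; rewrite gt_eqF// ltr_pwDl. Qed.

Lemma ucont_J n p : ucont (fun t : R => t ^+ n * cay t ^+ p).
Proof. by apply: ucontM; apply: ucontX; [exact: ucont_id|exact: ucont_cay]. Qed.

Lemma ucont_onepX2V : ucont (fun t : R => (1 + t ^+ 2)^-1).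
Proof.
apply: ucontV => [t _|]; first exact: onepX2_neq0.
by apply: ucontD; [exact: ucont_cst|apply: ucontX; exact: ucont_id].
Qed.

Lemma ucont_onepV : ucont (fun t : R => (1 + t)^-1).
Proof.
apply: ucontV => [t t01|]; first exact: onep_neq0.
by apply: ucontD; [exact: ucont_cst|exact: ucont_id].
Qed.

Lemma ucont_D p : ucont (fun t : R => cay t ^+ p / (1 + t ^+ 2)).
Proof.
by apply: ucontM; [apply: ucontX; exact: ucont_cay|exact: ucont_onepX2V].
Qed.

Lemma ucont_A p : ucont (fun t : R => cay t ^+ p / (1 + t)).
Proof.
by apply: ucontM; [apply: ucontX; exact: ucont_cay|exact: ucont_onepV].
Qed.

Lemma cay0 : cay 0 = 1 :> R. Proof. by rewrite /cay subr0 addr0 divr1. Qed.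
Lemma cay1 : cay 1 = 0 :> R. Proof. by rewrite /cay subrr mul0r. Qed.

Lemma uint_monomial n : uint (fun t : R => t ^+ n) = n.+1%:R^-1.
Proof.
rewrite (@uint_FTC _ _ (fun t => n.+1%:R^-1 * t ^+ n.+1)).
- by rewrite expr1n expr0n/= mulr0 subr0 mulr1.
- move=> x x01; have h := is_deriveZ n.+1%:R^-1 (is_derive_mono n.+1 x).
  apply: is_derive_eq h _.
  by rewrite /GRing.scale/= mulrA mulVf ?mul1r// pnatr_eq0.
- exact: ucontX ucont_id.
Qed.

Lemma Jint0 n : Jint n 0 = n.+1%:R^-1.
Proof.
by rewrite -uint_monomial; apply: eq_uint => t _; rewrite expr0 mulr1.
Qed.

Lemma is_derive_J n p (x : R) : 0 <= x ->
  is_derive x 1 (fun t : R => t ^+ n * cay t ^+ p)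
   (n%:R * x ^+ n.-1 * cay x ^+ p
    - x ^+ n * (p%:R * cay x ^+ p.-1 * (2 / (1 + x) ^+ 2))).
Proof.
move=> x0; have h := is_deriveM (is_derive_mono n x) (is_derive_cayX p x0).
apply: is_derive_eq h _; rewrite /GRing.scale/=.
by ring.
Qed.

(** Integration of the derivative of t^(n+1) q^(p+1), using
    4 t/(1+t)^2 = 1 - q^2. *)
Lemma Jint_rec_right n p :
  n.+1%:R * Jint n p.+1 = p.+1%:R / 2 * (Jint n p - Jint n p.+2).
Proof.
suff : uint (fun t : R => n.+1%:R * (t ^+ n * cay t ^+ p.+1) -
      p.+1%:R / 2 * (t ^+ n * cay t ^+ p - t ^+ n * cay t ^+ p.+2)) = 0.
  have hJ := @ucont_J.
  have hB : ucont (fun t : R => t ^+ n * cay t ^+ p - t ^+ n * cay t ^+ p.+2).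
    by move=> x x01; apply: continuousB; exact: hJ.
  rewrite uintB; [|by apply: ucontM; [exact: ucont_cst|exact: hJ]|
                   by apply: ucontM; [exact: ucont_cst|exact: hB]].
  by rewrite !uintZ// uintB// => /subr0_eq.
rewrite (@uint_FTC _ _ (fun t => t ^+ n.+1 * cay t ^+ p.+1)).
- by rewrite cay1 !expr0n/= mul0r mulr0 subrr.
- move=> x x01; have x0 : 0 <= x by case/andP: x01.
  apply: is_derive_eq (is_derive_J n.+1 p.+1 x0) _.
  have xn0 := onep_neq0 x01; rewrite /= !exprS.
  by move: (cay x ^+ p) (x ^+ n) => a b; rewrite /cay; field.
- move=> x x01; apply: continuousB; apply: continuousM; try exact: cvg_cst.
  + exact: ucont_J.
  + by apply: continuousB; exact: ucont_J.
Qed.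

(** Integration of the derivative of (t^(n+1) - t^(n+3)) q^p, using
    (1-t^2)/(1+t)^2 = q. *)
Lemma Jint_rec_left n p :
  n.+1%:R * Jint n p - n.+3%:R * Jint n.+2 p = p.*2%:R * Jint n.+1 p.
Proof.
suff : uint (fun t : R => n.+1%:R * (t ^+ n * cay t ^+ p) -
      n.+3%:R * (t ^+ n.+2 * cay t ^+ p) - p.*2%:R * (t ^+ n.+1 * cay t ^+ p)) = 0.
  have hJ := @ucont_J.
  have hZ (c : R) m : ucont (fun t : R => c * (t ^+ m * cay t ^+ p)).
    by apply: ucontM; [exact: ucont_cst|exact: hJ].
  have hB : ucont (fun t : R => n.+1%:R * (t ^+ n * cay t ^+ p) -
      n.+3%:R * (t ^+ n.+2 * cay t ^+ p)).
    by move=> x x01; apply: continuousB; exact: hZ.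
  by rewrite uintB// uintB// !uintZ// => /subr0_eq.
rewrite (@uint_FTC _ _ (fun t => t ^+ n.+1 * cay t ^+ p - t ^+ n.+3 * cay t ^+ p)).
- by rewrite !expr1n !expr0n/= !mul0r !subrr.
- move=> x x01; have x0 : 0 <= x by case/andP: x01.
  have h := is_deriveB (is_derive_J n.+1 p x0) (is_derive_J n.+3 p x0).
  apply: is_derive_eq h _.
  have xn0 := onep_neq0 x01; rewrite /= !exprS.
  case: p => [|p]; first by rewrite !mul0r; ring.
  rewrite !exprS -muln2 natrM.
  by move: (cay x ^+ p) (x ^+ n) => a b; rewrite /cay; field.
- move=> x x01; apply: continuousB; [apply: continuousB|]; apply: continuousM;
    by [exact: cvg_cst|exact: ucont_J].
Qed.

Lemma Jint_ge0 n p : 0 <= Jint n p.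
Proof.
apply: uint_ge0 => t t01; rewrite mulr_ge0 ?exprn_ge0 ?cay_ge0//.
by case/andP: t01.
Qed.

Lemma Jint_le_left n p : (0 < p)%N -> Jint n p <= (n.+1 * n.+2)%:R^-1.
Proof.
case: p => // p _.
rewrite (_ : _^-1 = uint (fun t : R => t ^+ n - t ^+ n.+1)).
  apply: uint_le; first exact: ucont_J.
    by move=> x x01; apply: continuousB; exact: ucontX ucont_id _ _.
  move=> t t01; have t0 : 0 <= t by case/andP: t01.
  rewrite [t ^+ n.+1]exprSr -[X in X - _]mulr1 -mulrBr ler_wpM2l ?exprn_ge0//.
  rewrite (le_trans _ (cay_le t01))// exprS ler_piMr ?cay_ge0//.
  by rewrite exprn_ile1 ?cay_ge0 ?cay_le1.
rewrite uintB; [|exact: ucontX ucont_id|exact: ucontX ucont_id].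
rewrite !uint_monomial natrM invfM -[n.+2%:R]natr1.
have : n.+1%:R != 0 :> R by rewrite pnatr_eq0.
have : n.+1%:R + 1 != 0 :> R by rewrite natr1 pnatr_eq0.
by move: (n.+1%:R : R) => a a1 a0; field; rewrite a0 a1.
Qed.

Lemma ucont_cay_measure p :
  ucont (fun t : R => cay t ^+ p * (2 / (1 + t) ^+ 2)).
Proof.
apply: ucontM; first exact: ucontX ucont_cay.
apply: ucontM; first exact: ucont_cst.
under eq_fun do rewrite -exprVn.
exact: ucontX ucont_onepV.
Qed.

(** dq = - 2 dt/(1+t)^2, hence this is the integral of q^p dq. *)
Lemma uint_cay_measure p :
  uint (fun t : R => cay t ^+ p * (2 / (1 + t) ^+ 2)) = p.+1%:R^-1.
Proof.
rewrite (@uint_FTC _ _ (fun t => - p.+1%:R^-1 * cay t ^+ p.+1)).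
- by rewrite cay1 cay0 expr1n expr0n/= mulr0 mulr1 opprK add0r.
- move=> x x01; have x0 : 0 <= x by case/andP: x01.
  have h := is_deriveZ (- p.+1%:R^-1) (is_derive_cayX p.+1 x0).
  apply: is_derive_eq h _; rewrite /GRing.scale/= mulrNN.
  by rewrite -!mulrA mulKf// pnatr_eq0.
- exact: ucont_cay_measure.
Qed.

Lemma Jint_le_right n p : Jint n p <= 2 * p.+1%:R^-1.
Proof.
rewrite -uint_cay_measure -uintZ; last exact: ucont_cay_measure.
apply: uint_le; first exact: ucont_J.
  by apply: ucontM; [exact: ucont_cst|exact: ucont_cay_measure].
move=> t t01; rewrite mulrCA mulrC ler_wpM2l ?exprn_ge0 ?cay_ge0//.
case/andP: t01 => t0 t1; rewrite (le_trans (exprn_ile1 _ t0 t1))//.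
rewrite mulrA ler_pdivlMr ?exprn_gt0 ?ltr_pwDl// mul1r expr2.
by rewrite ler_pM ?addr_ge0//; lra.
Qed.

(** (1 + q^2)/(1 + t^2) = 2/(1+t)^2. *)
Lemma Dint_rec p : Dint p + Dint p.+2 = p.+1%:R^-1.
Proof.
rewrite -uint_cay_measure -uintD; [|exact: ucont_D..].
apply: eq_uint => t t01; have t0 := onep_neq0 t01; have t2 := onepX2_neq0 t.
by rewrite !exprS; move: (cay t ^+ p) => a; rewrite /cay; field; rewrite t0 t2.
Qed.

(** (1 + q)/(1 + t) = 2/(1+t)^2. *)
Lemma Aint_rec p : Aint p + Aint p.+1 = p.+1%:R^-1.
Proof.
rewrite -uint_cay_measure -uintD; [|exact: ucont_A..].
apply: eq_uint => t t01; have t0 := onep_neq0 t01.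
by rewrite !exprS; move: (cay t ^+ p) => a; rewrite /cay; field.
Qed.

Lemma Dint_ge0 p : 0 <= Dint p.
Proof.
apply: uint_ge0 => t t01; rewrite divr_ge0 ?exprn_ge0 ?cay_ge0//.
by rewrite addr_ge0// sqr_ge0.
Qed.

Lemma Aint_ge0 p : 0 <= Aint p.
Proof.
apply: uint_ge0 => t t01; rewrite divr_ge0 ?exprn_ge0 ?cay_ge0//.
by rewrite addr_ge0//; case/andP: t01.
Qed.

Lemma Dint_le p : Dint p <= p.+1%:R^-1.
Proof. by rewrite -Dint_rec lerDl Dint_ge0. Qed.

Lemma Aint_le p : Aint p <= p.+1%:R^-1.
Proof. by rewrite -Aint_rec lerDl Aint_ge0. Qed.

Lemma Dint_decr p n : Dint (p + n) <= Dint p.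
Proof.
apply: uint_le; [exact: ucont_D..|move=> t t01].
rewrite ler_wpM2r ?invr_ge0 ?addr_ge0 ?sqr_ge0//.
by rewrite exprD ler_piMr ?exprn_ge0 ?cay_ge0// exprn_ile1 ?cay_ge0 ?cay_le1.
Qed.

Lemma Dint0 : Dint 0 = pi / 4.
Proof.
rewrite -atan1 -[RHS]subr0 -(@atan0 R); apply: uint_FTC.
  move=> x _; apply: is_derive_eq (is_derive1_atan x) _.
  by rewrite expr0 mul1r.
exact: ucont_D.
Qed.

Lemma Aint0 : Aint 0 = ln 2.
Proof.
rewrite /Aint (@uint_FTC _ _ (fun t => ln (1 + t))).
- by rewrite addr0 ln1 subr0.
- move=> x /andP[x0 _]; rewrite expr0 mul1r.
  have x1 : 0 < 1 + x by rewrite ltr_pwDl.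
  have h : is_derive x 1 (fun y : R => 1 + y) 1.
    apply: is_derive_eq (is_deriveD (is_derive_cst (1 : R) x 1) (is_derive_id x 1)) _.
  by rewrite add0r.
  have := @is_derive1_comp R (@ln R) _ x _ _ (is_derive1_ln x1) h.
  by rewrite mulr1.
- exact: ucont_A.
Qed.

Lemma geometric_alt (t : R) K :
  \sum_(0 <= j < K) (-1) ^+ j * t ^+ j.*2 = (1 - (-1) ^+ K * t ^+ K.*2) / (1 + t ^+ 2).
Proof.
have t2 := onepX2_neq0 t.
elim: K => [|K IH]; first by rewrite big_nil !expr0 mulr1 subrr mul0r.
by rewrite big_nat_recr//= IH doubleS !exprS; field.
Qed.

(** Integration against q^p of the truncated geometric expansion of t^s/(1+t^2). *)
Lemma Dint_expansion s K p :
  \sum_(0 <= j < K) (-1) ^+ j * Jint (j.*2 + s) p =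
  uint (fun t => t ^+ s * cay t ^+ p / (1 + t ^+ 2))
  - (-1) ^+ K * uint (fun t => t ^+ (K.*2 + s) * cay t ^+ p / (1 + t ^+ 2)).
Proof.
have hc n : ucont (fun t : R => t ^+ n * cay t ^+ p / (1 + t ^+ 2)).
  by apply: ucontM; [exact: ucont_J|exact: ucont_onepX2V].
rewrite -uintZ// -uintB//; last by apply: ucontM; [exact: ucont_cst|exact: hc].
rewrite (eq_bigr (fun j => uint (fun t => (-1) ^+ j * (t ^+ (j.*2 + s) * cay t ^+ p))));
  last by move=> j _; rewrite uintZ//; exact: ucont_J.
rewrite -uint_sum; last by move=> j; apply: ucontM; [exact: ucont_cst|exact: ucont_J].
apply: eq_uint => t t01.
transitivity (t ^+ s * cay t ^+ p * \sum_(0 <= j < K) (-1) ^+ j * t ^+ j.*2).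
  by rewrite mulr_sumr; apply: eq_bigr => j _; rewrite exprD; ring.
rewrite geometric_alt exprD; have t2 := onepX2_neq0 t.
by field.
Qed.

(** t/(1+t^2) = 1/(1+t) - q/(1+t^2). *)
Lemma uint_tD p : uint (fun t : R => t ^+ 1 * cay t ^+ p / (1 + t ^+ 2)) =
  Aint p - Dint p.+1.
Proof.
rewrite -uintB; [|exact: ucont_A|exact: ucont_D].
apply: eq_uint => t t01; have t0 := onep_neq0 t01; have t2 := onepX2_neq0 t.
by rewrite !exprS; move: (cay t ^+ p) => a; rewrite /cay; field; rewrite t0 t2.
Qed.

Lemma uint_0D p : uint (fun t : R => t ^+ 0 * cay t ^+ p / (1 + t ^+ 2)) = Dint p.
Proof. by apply: eq_uint => t _; rewrite expr0 mul1r. Qed.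

Lemma uint_tail_bound n p :
  `|uint (fun t : R => t ^+ n * cay t ^+ p / (1 + t ^+ 2))| <= n.+1%:R^-1.
Proof.
rewrite ger0_norm; last first.
  apply: uint_ge0 => t t01; rewrite divr_ge0 ?mulr_ge0 ?exprn_ge0 ?cay_ge0//.
    by case/andP: t01.
  by rewrite addr_ge0// sqr_ge0.
rewrite -uint_monomial; apply: uint_le.
- by apply: ucontM; [exact: ucont_J|exact: ucont_onepX2V].
- exact: ucontX ucont_id.
- move=> t t01; have t0 : 0 <= t by case/andP: t01.
  rewrite -mulrA ler_piMr ?exprn_ge0// mulr_ile1 ?exprn_ge0 ?cay_ge0//.
  + by rewrite invr_ge0 addr_ge0// sqr_ge0.
  + by rewrite exprn_ile1 ?cay_ge0 ?cay_le1.
  + by rewrite invf_le1 ?ltr_pwDl ?sqr_ge0// lerDl sqr_ge0.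
Qed.

End beta_integrals.

(** * Dominated convergence for series *)

Section tannery.
Context {R : realType}.
Implicit Types (f : nat -> nat -> R) (g h s : nat -> R).

Lemma cvg_bigsum (I : eqType) (r : seq I) (P : pred I) (u : I -> nat -> R)
    (l : I -> R) : (forall i, i \in r -> P i -> u i @ \oo --> l i) ->
  (fun n => \sum_(i <- r | P i) u i n) @ \oo --> \sum_(i <- r | P i) l i.
Proof.
elim: r => [|i r IH] h.
  by rewrite big_nil; under eq_fun do rewrite big_nil; exact: cvg_cst.
have {}IH : (fun n => \sum_(i <- r | P i) u i n) @ \oo --> \sum_(i <- r | P i) l i.
  by apply: IH => j jr Pj; apply: h; rewrite // inE jr orbT.
rewrite big_cons; under eq_fun do rewrite big_cons.
case: ifPn => // Pi; apply: cvgD => //; apply: h => //.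
by rewrite mem_head.
Qed.

Lemma series_tail_le g h (l : R) K : (forall i, `|g i| <= h i) ->
  cvgn (series h) -> series g @ \oo --> l ->
  `|l - series g K| <= limn (series h) - series h K.
Proof.
move=> gh hc gl.
have h0 i : 0 <= h i by exact: le_trans (gh i).
have hnd : nondecreasing_seq (series h).
  by apply/nondecreasing_seqP => n; rewrite seriesSr lerDl.
have dl : (fun n => `|series g n - series g K|) @ \oo --> `|l - series g K|.
  by apply: cvg_norm; apply: cvgB => //; exact: cvg_cst.
rewrite -(cvg_lim _ dl)//; apply: limr_le; first by apply/cvg_ex; exists `|l - series g K|.
near=> n; have Kn : (K <= n)%N by near: n; exact: nbhs_infty_ge.
rewrite sub_series_geq// (le_trans (ler_norm_sum _ _ _))//.
rewrite (@le_trans _ _ (series h n - series h K))//.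
  by rewrite sub_series_geq//; apply: ler_sum => i _.
by rewrite lerD2r; exact: nondecreasing_cvgn_le.
Unshelve. all: by end_near. Qed.

Lemma cvg_le_norm (u : nat -> R) (l c : R) : (forall n, `|u n| <= c) ->
  u @ \oo --> l -> `|l| <= c.
Proof.
move=> uc ul; have nl : `|u n| @[n --> \oo] --> `|l| by exact: cvg_norm.
rewrite -(cvg_lim _ nl)//; apply: limr_le; first by apply/cvg_ex; exists `|l|.
exact: nearW.
Qed.

Lemma series_dominated_cvg g h : (forall i, `|g i| <= h i) ->
  cvgn (series h) -> cvgn (series g).
Proof.
move=> gh hc; apply: normed_cvg; apply: series_le_cvg hc => i.
- exact: normr_ge0.
- by apply: le_trans (gh i); rewrite normr_ge0.
- exact: gh.
Qed.

(** Dominated convergence for series.  Since [s N] is the sum of the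
    series of [f N], this evaluates the limit of [s] when the series of [g]
    is known, and conversely. *)
Lemma tannery f g h s :
  cvgn (series h) -> (forall N i, `|f N i| <= h i) ->
  (forall i, f ^~ i @ \oo --> g i) ->
  (forall N, series (f N) @ \oo --> s N) ->
  cvgn (series g) /\ s @ \oo --> limn (series g).
Proof.
move=> hc fh fg fs.
have gh i : `|g i| <= h i by apply: cvg_le_norm (fg i) => N.
have gc := series_dominated_cvg gh hc.
split=> //; apply/cvgrPdist_le => e e0.
have e3 : 0 < e / 3 by rewrite divr_gt0.
have [K _ hK] : \forall K \near \oo, `|limn (series h) - series h K| <= e / 3.
  by move/cvgrPdist_le: hc => /(_ _ e3).
have {}hK : limn (series h) - series h K <= e / 3.
  by rewrite (le_trans _ (hK K _))//= ?ler_norm.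
have fgK : (fun N => series (f N) K) @ \oo --> series g K.
  by rewrite /series/=; apply: cvg_bigsum => i _ _; exact: fg.
move/cvgrPdist_le: fgK => /(_ _ e3) [N0 _ hN0].
exists N0 => // N /= N0N.
have h1 := series_tail_le K gh hc gc.
have h2 := series_tail_le K (fh N) hc (fs N).
have h3 := hN0 N N0N.
have -> : limn (series g) - s N = (limn (series g) - series g K) +
   (series g K - series (f N) K) - (s N - series (f N) K) by ring.
rewrite (le_trans (ler_normB _ _))//.
have -> : e = e / 3 + e / 3 + e / 3 by field.
apply: lerD; last exact: le_trans h2 hK.
rewrite (le_trans (ler_normD _ _))// lerD//; exact: le_trans h1 hK.
Qed.

Lemma cvg_invn : (fun n => n.+1%:R^-1 : R) @ \oo --> 0.
Proof. exact: cvg_harmonic. Qed.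

Lemma near_cvg_le0 (u v : nat -> R) : (\forall n \near \oo, `|u n| <= v n) ->
  v @ \oo --> 0 -> u @ \oo --> 0.
Proof.
move=> uv v0; apply/norm_cvg0P.
apply: (@squeeze_cvgr _ _ _ _ (fun=> 0) v) => //; last exact: cvg_cst.
by apply: filterS uv => n; rewrite normr_ge0.
Qed.

Lemma cvg_le0 (u v : nat -> R) : (forall n, `|u n| <= v n) ->
  v @ \oo --> 0 -> u @ \oo --> 0.
Proof. by move=> uv; apply: near_cvg_le0; exact: nearW. Qed.

Lemma cvg_subseq (u : nat -> R) (f : nat -> nat) (l : R) :
  f @ \oo --> \oo -> u @ \oo --> l -> (fun n => u (f n)) @ \oo --> l.
Proof. by move=> hf hu; apply: (@cvg_comp _ _ _ f u _ \oo). Qed.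

Lemma cvg_cst_sub0 (l : R) (u : nat -> R) : u @ \oo --> 0 ->
  (fun n => l - u n) @ \oo --> l.
Proof.
move=> u0; suff : (fun n => l - u n) @ \oo --> l - 0 by rewrite subr0.
by apply: cvgB => //; exact: cvg_cst.
Qed.

Lemma cvg_series_inv_sqr : cvgn (series (fun i => i.+1%:R ^- 2 : R)).
Proof.
have tele n : series (fun i => 2 * (i.+1%:R^-1 - i.+2%:R^-1) : R) n = 2 * (1 - n.+1%:R^-1).
  elim: n => [|n IH]; first by rewrite /series/= big_nil invr1 subrr mulr0.
  by rewrite seriesSr IH; ring.
(* 1/(i+1)^2 <= 2/((i+1)(i+2)), which telescopes *)
apply: (@series_le_cvg _ _ (fun i => 2 * (i.+1%:R^-1 - i.+2%:R^-1))).
- by move=> i; rewrite invr_ge0 exprn_ge0.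
- by move=> i; rewrite mulr_ge0// subr_ge0 lef_pV2 ?posrE// ler_nat.
- move=> i; rewrite -[i.+2%:R]natr1.
  have : 1 <= i.+1%:R :> R by rewrite ler1n.
  move: (i.+1%:R : R) => a a1.
  have a0 : a != 0 by rewrite gt_eqF//; lra.
  have a10 : a + 1 != 0 by rewrite gt_eqF//; lra.
  have -> : 2 * (a^-1 - (a + 1)^-1) = a ^- 2 * (2 * a / (a + 1)).
    by field; rewrite a0 a10.
  rewrite ler_peMr ?invr_ge0 ?sqr_ge0//; rewrite ler_pdivlMr; lra.
- apply/cvg_ex; exists (2 * (1 - 0)).
  rewrite (_ : series _ = fun n => 2 * (1 - n.+1%:R^-1)); last exact/funext.
  apply: cvgM; first exact: cvg_cst.
  by apply: cvgB; [exact: cvg_cst|exact: cvg_harmonic].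
Qed.

Lemma inv_odd_pow_le i k : (2 <= k)%N -> i.*2.+1%:R ^- k <= i.+1%:R ^- 2 :> R.
Proof.
move=> k2; rewrite lef_pV2 ?posrE ?exprn_gt0//.
apply: (@le_trans _ _ (i.*2.+1%:R ^+ 2)).
  by rewrite lerXn2r ?nnegrE// ler_nat ltnS -addnn leq_addr.
by rewrite ler_weXn2l// ler1n.
Qed.

End tannery.

(** * Duality for chain sums *)

Section duality.
Context {R : realType}.
Implicit Types (a E : nat -> R) (d k n p N : nat).

(** The chain sums with base [a]: chain a 0 n = a_n/n, and chain a (d+1) n is 1/n
    times the sum of chain a d k over the k < n of parity opposite to n.  Both
    vanish at n = 0 because 1/0 = 0. *)
Fixpoint chain a d n : R :=
  (if d is d'.+1 then \sum_(0 <= k < n | odd k != odd n) chain a d' k else a n)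
  / n%:R.

Lemma chainE0 a n : chain a 0 n = a n / n%:R. Proof. by []. Qed.

Lemma chainES a d n :
  chain a d.+1 n = (\sum_(0 <= k < n | odd k != odd n) chain a d k) / n%:R.
Proof. by []. Qed.

Arguments chain : simpl never.

Lemma chain0n a d : chain a d 0 = 0.
Proof. by case: d => [|d]; rewrite (chainE0, chainES) invr0 mulr0. Qed.

Lemma cvg_mean0 (u : nat -> R) : u @ \oo --> 0 ->
  (fun n => n%:R^-1 * series u n) @ \oo --> 0.
Proof. by move=> /cesaro u0; rewrite -(cvg_shiftS (fun n => n%:R^-1 * series u n)). Qed.

Lemma cvg_chain0 a d : (forall n, `|a n| <= 1) -> chain a d @ \oo --> 0.
Proof.
move=> a1; elim: d => [|d IH].
  rewrite -cvg_shiftS; apply: cvg_le0 cvg_invn => n; rewrite /=.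
  by rewrite chainE0 normrM normfV normr_nat ler_piMl.
have {}IH : (fun n => `|chain a d n|) @ \oo --> 0 by apply/norm_cvg0P.
apply: cvg_le0 (cvg_mean0 IH) => n; rewrite chainES.
rewrite normrM normfV normr_nat mulrC ler_wpM2l ?invr_ge0//.
rewrite (le_trans (ler_norm_sum _ _ _))// /series/= big_mkcond/=.
by apply: ler_sum => i _; case: ifP.
Qed.

(** n \int_0^1 t^(n-1) q^p dt, with value 0 at n = 0. *)
Definition connector n p : R := n%:R * Jint n.-1 p.

Lemma connector_ge0 n p : 0 <= connector n p.
Proof. by rewrite mulr_ge0// Jint_ge0. Qed.

Lemma connector_le n p : (0 < p)%N -> connector n p <= n.+1%:R^-1.
Proof.
case: n => [|n] p0; first by rewrite /connector mul0r invr_ge0.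
have := Jint_le_left (R := R) n p0; rewrite natrM invfM /connector /=.
by rewrite -(ler_pM2l (x := n.+1%:R)) ?ltr0n// mulrA mulfV ?mul1r// pnatr_eq0.
Qed.

(** The sum of (2p/n) C(n,p) over k < n < N with n - k odd telescopes; the index of
    the remaining term is whichever of N - 1 and N has the parity of k. *)
Lemma connector_transport k N p : (0 < k)%N -> (k < N)%N ->
  \sum_(0 <= n < N | (k < n)%N && (odd k != odd n)) p.*2%:R * Jint n.-1 p =
  connector k p - connector (N - (odd k != odd N)) p.
Proof.
move=> k0; elim: N => // N IH; rewrite ltnS leq_eqVlt => /predU1P[->|kN].
  rewrite big_nat_cond big1 => [|i /andP[/andP[_ iN] /andP[Ni _]]]; last first.
    by rewrite ltnS leqNgt Ni in iN.
  by rewrite /=; case: (odd N); rewrite subn1 subrr.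
rewrite big_mkcond big_nat_recr//= -big_mkcond/= IH// kN /=.
rewrite -if_neg negbK; case: (odd k =P odd N) => [->|kNo].
  by case: (odd N); rewrite subn0 subn1 addr0.
have -> : (odd k == ~~ odd N) by case: (odd k) (odd N) kNo => [] [].
case: N kN {IH kNo} => // N kN; rewrite subn0 subn1/=.
case: N kN => [|N kN]; first by case: k k0.
rewrite -Jint_rec_left /connector/=.
by ring.
Qed.

(** Summation by parts: one step of the chain is traded for a factor 1/(2p), up to
    a boundary term. *)
Lemma chain_connector_rec a d N p : (0 < p)%N ->
  p.*2%:R * \sum_(0 <= n < N) chain a d.+1 n * connector n p =
  \sum_(0 <= k < N) chain a d k * connector k p
  - \sum_(0 <= k < N) chain a d k * connector (N - (odd k != odd N)) p.
Proof.
move=> p0; rewrite -sumrB mulr_sumr.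
under [RHS]eq_bigr do rewrite -mulrBr.
transitivity (\sum_(0 <= n < N) \sum_(0 <= k < N | (k < n)%N && (odd k != odd n))
    chain a d k * (p.*2%:R * Jint n.-1 p)).
  apply: eq_big_nat => n /andP[_ nN].
  rewrite -mulr_suml.
  rewrite (big_cat_nat (n := n) (p := N)) ?(ltnW nN)//.
  rewrite [X in _ = (_ + X) * _]big_nat_cond [X in _ = (_ + X) * _]big1 ?addr0; last first.
    by move=> i /andP[/andP[ni _]]; rewrite ltnNge ni.
  rewrite [X in _ = X * _](_ : _ = \sum_(0 <= k < n | odd k != odd n) chain a d k); last first.
    rewrite big_nat_cond [RHS]big_nat_cond; apply: eq_bigl => k.
    by case: (k < n)%N.
  case: n nN => [|n] nN; first by rewrite chain0n big_nil !mul0r mulr0.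
  rewrite /connector chainES.
  have : n.+1%:R != 0 :> R by rewrite pnatr_eq0.
  by move: (n.+1%:R : R) => c c0; field.
rewrite (exchange_big_dep_nat xpredT)//=.
apply: eq_big_nat => k /andP[_ kN].
rewrite -mulr_sumr.
case: k kN => [|k] kN; first by rewrite chain0n !mul0r.
by rewrite connector_transport.
Qed.

(** The boundary terms are at most the means of |chain a d k| over k < N, which
    tend to 0 by Cesaro's lemma. *)
Lemma chain_connector_cvg a E d p : (forall n, `|a n| <= 1) -> a 0 = 0 ->
  (0 < p)%N ->
  (fun N => \sum_(0 <= k < N) a k * Jint k.-1 p) @ \oo --> E p ->
  (fun N => \sum_(0 <= n < N) chain a d n * connector n p) @ \oo -->
     p.*2%:R ^- d * E p.
Proof.
move=> a1 a0 p0 Ep; have p2 : p.*2%:R != 0 :> R by rewrite pnatr_eq0 double_eq0 -lt0n.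
elim: d => [|d IH].
  rewrite expr0 invr1 mul1r.
  under eq_fun => N.
    rewrite (_ : \sum_(_ <= _ < _) _ = \sum_(0 <= k < N) a k * Jint k.-1 p); first over.
    apply: eq_big_nat => -[|k] _; first by rewrite chain0n a0 !mul0r.
    by rewrite chainE0 /connector /= mulrA divfK// pnatr_eq0.
  exact: Ep.
have err : (fun N => \sum_(0 <= k < N) chain a d k *
    connector (N - (odd k != odd N)) p) @ \oo --> 0.
  have h : (fun n => `|chain a d n|) @ \oo --> 0 by apply/norm_cvg0P; exact: cvg_chain0.
  apply: cvg_le0 (cvg_mean0 h) => N.
  rewrite (le_trans (ler_norm_sum _ _ _))// /series/= mulr_sumr.
  apply: ler_sum_nat => k /andP[_ kN].
  rewrite normrM mulrC ler_wpM2r// ger0_norm ?connector_ge0//.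
  rewrite (le_trans (connector_le _ p0))// lef_pV2 ?posrE ?ltr0n ?ler_nat//; last first.
    exact: leq_ltn_trans kN.
  by case: (_ != _) => /=; rewrite ?subn0// subn1; case: N {h kN}.
rewrite exprS invfM -mulrA -[p.*2%:R ^- d * _]subr0.
have -> : (fun N => \sum_(0 <= n < N) chain a d.+1 n * connector n p) =
    fun N => p.*2%:R^-1 * (\sum_(0 <= k < N) chain a d k * connector k p -
      \sum_(0 <= k < N) chain a d k * connector (N - (odd k != odd N)) p).
  by apply/funext => N; rewrite -chain_connector_rec// mulKf.
by apply: cvgM; [exact: cvg_cst|exact: cvgB].
Qed.

Lemma chain_ge0 a d n : (forall n, 0 <= chain a 1 n) -> 0 <= chain a d.+1 n.
Proof.
move=> a0; elim: d n => // d IH n.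
by rewrite chainES divr_ge0// sumr_ge0.
Qed.

(** Truncation of 1/n = \sum_(p odd) (2/p) C(n,p). *)
Lemma connector_expansion n P :
  \sum_(0 <= i < P) 2 / i.*2.+1%:R * connector n.+1 i.*2.+1 =
  n.+1%:R^-1 - Jint n P.*2.
Proof.
elim: P => [|P IH]; first by rewrite big_nil Jint0 subrr.
rewrite big_nat_recr//= IH doubleS /connector /= Jint_rec_right.
have : P.*2.+1%:R != 0 :> R by rewrite pnatr_eq0.
by move: (P.*2.+1%:R : R) => c c0; field; rewrite c0 nat1r pnatr_eq0.
Qed.

Lemma cvg_double : (fun n => n.*2) @ \oo --> \oo.
Proof.
move=> A [N _ hN]; exists N => // n /= Nn; apply: hN => /=.
by rewrite -addnn (leq_trans Nn)// leq_addr.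
Qed.

(** Both sides are limits of the truncations at n < N, with the sum over p odd
    inside.  As the chain sums are nonnegative from level 1 on, for each p the
    truncated term increases to its limit, which is at most 1/p^2. *)
Theorem chain_duality a E d : (forall n, `|a n| <= 1) -> a 0 = 0 ->
  (forall n, 0 <= chain a 1 n) -> (forall p, E p <= 1) ->
  (forall p, (0 < p)%N ->
    (fun N => \sum_(0 <= k < N) a k * Jint k.-1 p) @ \oo --> E p) ->
  let g i := 2 / i.*2.+1%:R * (i.*2.+1.*2%:R ^- d.+1 * E i.*2.+1) in
  cvgn (series g) /\
  (fun N => \sum_(0 <= n < N) chain a d.+1 n / n%:R) @ \oo --> limn (series g).
Proof.
move=> a1 a0 c1 E1 Ep g.
pose u N p := \sum_(0 <= n < N) chain a d.+1 n * connector n p.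
have uE p : (0 < p)%N -> u ^~ p @ \oo --> p.*2%:R ^- d.+1 * E p.
  by move=> p0; exact: chain_connector_cvg (Ep _ p0).
have t0 N p n : 0 <= chain a d.+1 n * connector n p.
  by rewrite mulr_ge0 ?connector_ge0 ?chain_ge0.
have u0 N p : 0 <= u N p by apply: sumr_ge0 => n _; exact: t0.
have ule N p : (0 < p)%N -> u N p <= p.*2%:R ^- d.+1 * E p.
  move=> p0; rewrite -(cvg_lim _ (uE _ p0))//.
  apply: (@nondecreasing_cvgn_le _ (u ^~ p)).
    by apply/nondecreasing_seqP => n; rewrite /u big_nat_recr// lerDl; exact: t0.
  by apply/cvg_ex; eexists; exact: uE.
apply: (@tannery _ (fun N i => 2 / i.*2.+1%:R * u N i.*2.+1) g
   (fun i => i.+1%:R ^- 2)).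
- exact: cvg_series_inv_sqr.
- move=> N i; have hp : (0 : R) < i.*2.+1%:R by rewrite ltr0n.
  rewrite ger0_norm ?mulr_ge0 ?divr_ge0//.
  apply: (@le_trans _ _ (2 / i.*2.+1%:R * i.*2.+1.*2%:R^-1)).
    rewrite ler_wpM2l ?divr_ge0// (le_trans (ule _ _ _))//.
    rewrite (@le_trans _ _ (i.*2.+1.*2%:R ^- d.+1))//.
      by rewrite ler_piMr ?invr_ge0 ?exprn_ge0.
    rewrite -!exprVn exprS ler_piMr ?invr_ge0// exprn_ile1 ?invr_ge0//.
    by rewrite invf_le1 ?ltr0n// ler1n.
  have -> : 2 / i.*2.+1%:R * i.*2.+1.*2%:R^-1 = i.*2.+1%:R ^- 2 :> R.
    rewrite -[i.*2.+1.*2]muln2 natrM; move: (i.*2.+1%:R : R) hp => c c0.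
    by field; rewrite gt_eqF.
  exact: inv_odd_pow_le.
- move=> i; apply: cvgM; first exact: cvg_cst.
  exact: uE.
- move=> N.
  have -> : series (fun i => 2 / i.*2.+1%:R * u N i.*2.+1) = fun P =>
     \sum_(0 <= n < N) chain a d.+1 n * (n%:R^-1 - Jint n.-1 P.*2).
    apply/funext => P; rewrite /series/=; under eq_bigr do rewrite mulr_sumr.
    rewrite exchange_big; apply: eq_big_nat => -[|n] _.
      by rewrite chain0n mul0r big1// => i _; rewrite mul0r mulr0.
    rewrite -connector_expansion mulr_sumr; apply: eq_bigr => i _.
    by rewrite mulrCA.
  apply: cvg_bigsum => n _ _.
  have -> : chain a d.+1 n / n%:R = chain a d.+1 n * (n%:R^-1 - 0) by rewrite subr0.
  apply: cvgM; first exact: cvg_cst.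
  apply: cvgB; first exact: cvg_cst.
  apply: (@cvg_comp _ _ _ _ (fun P => Jint n.-1 P) _ \oo); first exact: cvg_double.
  apply: (@cvg_le0 _ _ (fun p => 2 * p.+1%:R^-1)) => [p|].
    by rewrite ger0_norm ?Jint_ge0 ?Jint_le_right.
  rewrite -(mulr0 2); apply: cvgM; [exact: cvg_cst|exact: cvg_invn].
Qed.

End duality.

Arguments chain : simpl never.

(** * Chain sums with an alternating base sequence *)

Section alternating_base.
Context {R : realType}.
Implicit Types (s k n p N : nat).

(** The sequence equal to (-1)^j at k = 2j+1+s and to 0 elsewhere; for
    k <= s the natural subtraction gives 0, as it should.  Only s = 0 and s = 1 are
    used, and [altseq 0] is the nontrivial Dirichlet character modulo 4. *)
Definition altseq s k : R := if odd (k - s) then (-1) ^+ (k - s)./2 else 0.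

(** \int_0^1 t^s q^p/(1+t^2) dt. *)
Definition tailint s p : R := uint (fun t : R => t ^+ s * cay t ^+ p / (1 + t ^+ 2)).

Lemma sum_altseq s (h : nat -> R) N :
  \sum_(0 <= k < N) altseq s k * h k =
  \sum_(0 <= j < (N - s)./2) (-1) ^+ j * h (j.*2 + s).+1.
Proof.
elim: N => [|N IH]; first by rewrite sub0n !big_nil.
rewrite big_nat_recr//= {}IH /altseq; case: (leqP s N) => [sN|Ns]; last first.
  have -> : (N - s = 0)%N by apply/eqP; rewrite subn_eq0 ltnW.
  have -> : (N.+1 - s = 0)%N by apply/eqP; rewrite subn_eq0.
  by rewrite /= mul0r addr0.
rewrite subSn//=; move: (odd_double_half (N - s)).
rewrite uphalf_half; case: (odd _) => /= NE.
  rewrite add1n big_nat_recr//=; congr (_ + _ * h _).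
  by rewrite -addSn -add1n NE subnK.
by rewrite add0n mul0r addr0.
Qed.

Lemma cvg_half s : (fun N => (N - s)./2) @ \oo --> \oo.
Proof.
move=> A [M _ hM]; exists (M.*2 + s)%N => // N /= MN; apply: hM => /=.
by rewrite -(doubleK M) half_leq// leq_subRL ?(leq_trans _ MN) ?leq_addl// addnC.
Qed.

Lemma cvg_tailint s p :
  (fun N => \sum_(0 <= k < N) altseq s k * Jint k.-1 p) @ \oo --> tailint s p.
Proof.
under eq_fun do rewrite sum_altseq.
apply: (@cvg_comp _ _ _ _ (fun K => \sum_(0 <= j < K) (-1) ^+ j * Jint (j.*2 + s) p)
  _ \oo); first exact: cvg_half.
rewrite (_ : (fun K => _) = fun K => tailint s p -
  (-1) ^+ K * uint (fun t => t ^+ (K.*2 + s) * cay t ^+ p / (1 + t ^+ 2))); last first.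
  by apply/funext => K; rewrite Dint_expansion.
apply: cvg_cst_sub0.
apply: cvg_le0 cvg_invn => K; rewrite /=.
rewrite normrM normrX normrN1 expr1n mul1r.
rewrite (le_trans (uint_tail_bound _ _))// lef_pV2 ?posrE// ler_nat ltnS.
by rewrite -addnn -addnA leq_addr.
Qed.

Lemma Dint_partial s K : \sum_(0 <= j < K) (-1) ^+ j * (j.*2 + s).+1%:R^-1 =
  Dint s - (-1) ^+ K * Dint (s + K.*2) :> R.
Proof.
elim: K => [|K IH]; first by rewrite big_nil addn0 mul1r subrr.
by rewrite big_nat_recr//= IH -Dint_rec doubleS !addnS (addnC s) exprS; ring.
Qed.

Lemma altseq_le1 s k : `|altseq s k| <= 1.
Proof.
by rewrite /altseq; case: ifP => _; rewrite ?normr0// normrX normrN1 expr1n.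
Qed.

Lemma altseq0 s : altseq s 0 = 0.
Proof. by rewrite /altseq sub0n. Qed.

Lemma altseq_parity s k : (s <= 1)%N -> odd k == odd s -> altseq s k = 0.
Proof.
case: s => [|[|]]// _; first by rewrite /altseq subn0 => /eqP ->.
by case: k => [|k]; rewrite /altseq// subn1/= => /eqP; case: (odd k).
Qed.

(** The inner sum is 0 or a partial sum of 1/(s+1) - 1/(s+3) + 1/(s+5) - ... *)
Lemma chain1_altseq_ge0 s n : (s <= 1)%N -> 0 <= chain (altseq s) 1 n.
Proof.
move=> s1; rewrite chainES divr_ge0//.
have [nE|nE] := eqVneq (odd n) (odd s); last first.
  rewrite big1// => k kn; rewrite chainE0 altseq_parity ?mul0r//.
  by move: kn nE; case: (odd k) (odd n) (odd s) => [] [] [].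
rewrite big_mkcond/=.
have -> : \sum_(0 <= k < n) (if odd k != odd n then chain (altseq s) 0 k else 0) =
  \sum_(0 <= k < n) altseq s k * k%:R^-1.
  apply: eq_bigr => k _; rewrite chainE0; case: ifPn => //.
  by rewrite negbK nE => ks; rewrite altseq_parity ?mul0r.
rewrite sum_altseq Dint_partial subr_ge0 -signr_odd.
have := Dint_decr (R := R) s ((n - s)./2.*2).
have := Dint_ge0 (R := R) (s + (n - s)./2.*2).
by case: (odd _) => /= h1 h2; rewrite ?expr1 ?expr0 ?mulN1r ?mul1r//; lra.
Qed.

Lemma tailint_le1 s p : tailint s p <= 1.
Proof.
apply: le_trans (ler_norm _) _; apply: le_trans (uint_tail_bound _ _) _.
by rewrite invf_le1 ?ltr0n// ler1n.
Qed.

Lemma chain_altseq_cvg s d : (s <= 1)%N ->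
  cvgn (series (fun i => i.*2.+1%:R ^- d.+2 * tailint s i.*2.+1)) /\
  (fun N => 2 ^+ d.+1 * \sum_(0 <= n < N) chain (altseq s) d.+1 n / n%:R) @ \oo -->
  2 * limn (series (fun i => i.*2.+1%:R ^- d.+2 * tailint s i.*2.+1)).
Proof.
move=> s1.
have [gc gl] := chain_duality d (@altseq_le1 s) (altseq0 s)
  (fun n => chain1_altseq_ge0 n s1) (tailint_le1 s) (fun p _ => @cvg_tailint s p).
set g := (fun i => _) in gc gl.
set h := (fun i => i.*2.+1%:R ^- d.+2 * tailint s i.*2.+1).
have hE : h = (2 ^+ d.+1 / 2) *: g.
  apply/funext => i; rewrite /h /g fctE /GRing.scale/=.
  rewrite -[i.*2.+1.*2]muln2 natrM exprMn [in LHS]exprS.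
  have : i.*2.+1%:R != 0 :> R by rewrite pnatr_eq0.
  move: (i.*2.+1%:R : R) => c c0.
  have : c ^+ d.+1 != 0 by rewrite expf_neq0.
  have : (2 : R) ^+ d.+1 != 0 by rewrite expf_neq0.
  by move: (c ^+ d.+1) (2 ^+ d.+1) => x y y0 x0; field; rewrite c0 x0 y0.
have hc : cvgn (series h) by rewrite hE; exact: is_cvg_seriesZ.
split=> //; rewrite hE lim_seriesZ// /GRing.scale/= mulrA mulrCA divff// mulr1.
by apply: cvgM => //; exact: cvg_cst.
Qed.

End alternating_base.

(** * Multiple sums over alternating indices as chain sums *)

Section chain_sums.
Context {R : realType}.
Implicit Types (a F : nat -> R) (b : bool) (d N : nat).

(** The strictly decreasing sequences of positive integers n_0 > ... > n_d, below N,
    with alternating parities, n_0 being odd exactly when [b] is true.  At b = true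
    this is [alternating_index]. *)
Definition parity_index b d N (n : {ffun 'I_d.+1 -> 'I_N}) : bool :=
  [&& [forall i, (0 < n i)%N],
      [forall i : 'I_d.+1, forall j : 'I_d.+1, (i < j)%N ==> (n j < n i)%N]
    & [forall i : 'I_d.+1, odd (n i) == b (+) odd i]].

(** Prepending a value to a finite sequence. *)
Definition ffun_cons d N (k : 'I_N) (n : {ffun 'I_d -> 'I_N}) : {ffun 'I_d.+1 -> 'I_N} :=
  [ffun i => oapp n k (unlift ord0 i)].

Lemma ffun_cons0 d N (k : 'I_N) (n : {ffun 'I_d -> 'I_N}) : ffun_cons k n ord0 = k.
Proof. by rewrite ffunE unlift_none. Qed.

Lemma ffun_consS d N (k : 'I_N) (n : {ffun 'I_d -> 'I_N}) i :
  ffun_cons k n (lift ord0 i) = n i.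
Proof. by rewrite ffunE liftK. Qed.

Lemma sum_ffun_cons d N (G : {ffun 'I_d.+1 -> 'I_N} -> R) (P : pred {ffun 'I_d.+1 -> 'I_N}) :
  \sum_(n | P n) G n =
  \sum_(k < N) \sum_(n : {ffun 'I_d -> 'I_N} | P (ffun_cons k n)) G (ffun_cons k n).
Proof.
rewrite (reindex (fun p : 'I_N * {ffun 'I_d -> 'I_N} => ffun_cons p.1 p.2))/=.
  by rewrite pair_big_dep.
exists (fun n => (n ord0, [ffun i => n (lift ord0 i)])) => [[k n] _|n _] /=.
  rewrite ffun_cons0; congr (_, _); apply/ffunP => i.
  by rewrite ffunE ffun_consS.
by apply/ffunP => i; rewrite ffunE; case: unliftP => [j|] -> //=; rewrite ffunE.
Qed.

Lemma parity_index_cons b d N (k : 'I_N) (n : {ffun 'I_d.+1 -> 'I_N}) :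
  parity_index b (ffun_cons k n) =
  [&& (n ord0 < k)%N, odd k == b & parity_index (~~ b) n].
Proof.
apply/and3P/and3P => [[/forallP pos /forallP dec /forallP par]|
  [nk kb /and3P[/forallP pos /forallP dec /forallP par]]].
  split.
  - by have /forallP/(_ (lift ord0 ord0)) := dec ord0; rewrite ffun_consS ffun_cons0.
  - by have := par ord0; rewrite ffun_cons0 addbF.
  - apply/and3P; split; apply/forallP => i.
    + by have := pos (lift ord0 i); rewrite ffun_consS.
    + apply/forallP => j.
      by have /forallP/(_ (lift ord0 j)) := dec (lift ord0 i); rewrite !ffun_consS.
    + by have := par (lift ord0 i); rewrite ffun_consS /= addbN addNb.
have nk' j : (n j < k)%N.
  have [->//|j0] := eqVneq j ord0.
  by have /forallP/(_ j)/implyP := dec ord0; rewrite lt0n => /(_ j0) /ltn_trans; exact.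
split; apply/forallP => i; case: (unliftP ord0 i) => [i' ->|->].
- by rewrite ffun_consS.
- by rewrite ffun_cons0 (leq_ltn_trans _ nk).
- apply/forallP => j; case: (unliftP ord0 j) => [j' ->|->//].
  by rewrite !ffun_consS; have /forallP/(_ j') := dec i'.
- apply/forallP => j; case: (unliftP ord0 j) => [j' ->|->//].
  by rewrite ffun_consS ffun_cons0 nk' implybT.
- by rewrite ffun_consS /= addbN -addNb.
- by rewrite ffun_cons0 addbF.
Qed.

(** The weight [F] on the largest index makes the induction on the depth possible:
    it absorbs the constraint that this index is below the one prepended to it. *)
Lemma sum_parity_index a F b d N :
  \sum_(n : {ffun 'I_d.+1 -> 'I_N} | parity_index b n)
     F (n ord0) * (a (n ord_max) / \prod_(i < d.+1) (n i)%:R) =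
  \sum_(k < N | odd k == b) F k * chain a d k.
Proof.
elim: d F b => [|d IH] F b.
  rewrite sum_ffun_cons [RHS]big_mkcond/=; apply: eq_bigr => k _.
  have n0 : {ffun 'I_0 -> 'I_N} by exact: ffun0 (card_ord 0).
  rewrite big_mkcond (big_pred1 n0) => [|n]; last first.
    by apply/esym/eqP/ffunP => -[].
  rewrite (ord1 ord_max) ffun_cons0 big_ord_recl big_ord0 mulr1 ffun_cons0 chainE0.
  have -> : parity_index b (ffun_cons k n0) = (0 < k)%N && (odd k == b).
    apply/and3P/andP => [[/forallP/(_ ord0) pos _ /forallP/(_ ord0) par]|[k0 kb]].
      by move: pos par; rewrite ffun_cons0 addbF.
    split; apply/forallP => i; rewrite (ord1 i) ?ffun_cons0 ?addbF//.
    by apply/forallP => j; rewrite (ord1 j).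
  case: (posnP k) => [->|]; last by [].
  by rewrite invr0 !mulr0; case: ifP.
rewrite sum_ffun_cons [RHS]big_mkcond/=; apply: eq_bigr => k _.
case: ifPn => kb; last first.
  by rewrite big1// => n; rewrite parity_index_cons (negbTE kb) andbF.
rewrite chainES.
transitivity (F k / k%:R * \sum_(n : {ffun 'I_d.+1 -> 'I_N} | parity_index (~~ b) n)
   (n ord0 < k)%:R * (a (n ord_max) / \prod_(i < d.+1) (n i)%:R)).
  rewrite mulr_sumr big_mkcond [RHS]big_mkcond/=; apply: eq_bigr => n _.
  rewrite parity_index_cons kb /=; case: ifPn; last first.
    by rewrite negb_and => /orP[/negbTE->|/negbTE->]//; case: ifP; rewrite ?mul0r ?mulr0.
  move=> /andP[-> ->]; rewrite mul1r ffun_cons0.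
  have -> : ord_max = lift ord0 ord_max :> 'I_d.+2 by apply/val_inj.
  rewrite ffun_consS big_ord_recl ffun_cons0.
  rewrite (eq_bigr (fun i => (n i)%:R)) => [|i _]; last by rewrite ffun_consS.
  by rewrite invfM; ring.
rewrite (IH (fun m => (m < k)%N%:R)) -mulrA; congr (_ * _); rewrite mulrC; congr (_ * _).
rewrite (big_nat_widen 0 k N)/=; last exact: ltnW.
rewrite big_mkord big_mkcond [RHS]big_mkcond/=; apply: eq_bigr => j _.
rewrite (eqP kb); case: (odd j) b {kb} => [] []//=; by case: ltnP; rewrite ?mul1r ?mul0r.
Qed.

Lemma sum_alternating_index a d N :
  \sum_(n : {ffun 'I_d.+1 -> 'I_N} | alternating_index n)
    a (n ord_max) / index_weight R n =
  \sum_(0 <= k < N | odd k) chain a d k / k%:R.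
Proof.
rewrite big_mkord.
transitivity (\sum_(k < N | odd k == true) k%:R^-1 * chain a d k); last first.
  by apply: eq_big => [k|k _]; [rewrite eqb_id|rewrite mulrC].
rewrite -(sum_parity_index a (fun k => k%:R^-1)); apply: eq_big => // n _.
rewrite /index_weight [X in _ = _ * (_ / X)](bigD1 ord0)//=.
by rewrite expr2 !invfM; ring.
Qed.

Lemma chain_altseq_parity s d k : (s <= 1)%N -> odd k = odd (s + d) ->
  chain (altseq s) d k = 0 :> R.
Proof.
move=> s1; elim: d k => [|d IH] k ks.
  by rewrite chainE0 altseq_parity ?mul0r// ks addn0.
rewrite chainES big1 ?mul0r// => j jk; apply: IH.
by move: jk; rewrite ks addnS /=; case: (odd j) (odd (s + d)) => [] [].
Qed.

Lemma sum_chain_odd s d N : (s <= 1)%N -> odd (s + d) = false ->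
  \sum_(0 <= k < N | odd k) chain (altseq s) d k / k%:R =
  \sum_(0 <= k < N) chain (altseq s) d k / k%:R :> R.
Proof.
move=> s1 sd; rewrite big_mkcond/=; apply: eq_bigr => k _.
case: ifPn => // /negbTE ke; rewrite chain_altseq_parity ?mul0r//.
by rewrite ke sd.
Qed.

Lemma alternating_index_last d N (n : {ffun 'I_d.+1 -> 'I_N}) :
  alternating_index n -> (0 < n ord_max)%N /\ odd (n ord_max) = ~~ odd d.
Proof. by move=> /and3P[/forallP/(_ ord_max) ? _ /forallP/(_ ord_max)/eqP ?]. Qed.

Lemma multT_partialE m N : multT_partial R m N =
  - (2 * (2 ^+ (2 * m) * \sum_(0 <= k < N) chain (altseq 0) (2 * m) k / k%:R)).
Proof.
rewrite /multT_partial addn1 exprS mulNr mulrA -sum_chain_odd//; last first.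
  by rewrite add0n mul2n odd_double.
rewrite -sum_alternating_index; congr (- (_ * _)).
apply: eq_bigr => n /alternating_index_last[n0 no]; congr (_ / _).
have {}no : odd (n ord_max) by rewrite no mul2n odd_double.
rewrite /altseq subn0 no divn2.
move: n0 no; case: (nat_of_ord (n ord_max)) => // k _ /= ko.
by rewrite subn1 /= uphalf_half (negbTE ko).
Qed.

Lemma multS_partialE m N : (0 < m)%N -> multS_partial R m N =
  - (2 * (2 ^+ (2 * m).-1 * \sum_(0 <= k < N) chain (altseq 1) (2 * m).-1 k / k%:R)).
Proof.
move=> m0; have m2 : (0 < 2 * m)%N by rewrite muln_gt0.
have oE : odd (2 * m).-1.
  by rewrite -[X in is_true X]negbK -oddS prednK// mul2n odd_double.
rewrite /multS_partial -{1}(prednK m2) exprS mulrA -mulrN -sum_chain_odd//; last first.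
  by rewrite add1n /= oE.
rewrite -sum_alternating_index; congr (_ * _); rewrite -sumrN.
apply: eq_bigr => n /alternating_index_last[n0]; rewrite oE/= => no.
rewrite /altseq divn2 -mulNr; congr (_ / _).
move: n0 no; case: (nat_of_ord (n ord_max)) => // k _ /= /negbFE ko.
by rewrite subn1 /= ko uphalf_half ko add1n exprS mulN1r.
Qed.

End chain_sums.

(** * Partial fractions and the double series *)

Section partial_fractions.
Context {R : realType}.
Implicit Types (n p i M N P : nat).

Lemma cvg_inv_double (c : R) : (fun P => (c + P.*2%:R)^-1) @ \oo --> 0.
Proof.
rewrite -cvg_shiftS; apply: near_cvg_le0 cvg_invn.
exists (Num.bound `|c|) => // P /= cP.
have cb : `|c| < P.+1%:R.
  by rewrite (lt_le_trans (archi_boundP (normr_ge0 _)))// ler_nat (leq_trans cP) ?leqnSn.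
have h : P.+1%:R <= c + P.+1.*2%:R.
  have := ler_norm (- c); rewrite normrN -addnn natrD; lra.
have h0 : 0 < c + P.+1.*2%:R by apply: lt_le_trans h; rewrite ltr0n.
by rewrite ger0_norm ?invr_ge0 ?(ltW h0)// lef_pV2 ?posrE.
Qed.

(** The symmetric sums of 1/(n+r) over the odd integers r with |r| < 2P; the term of
    zero denominator, if any, is 0. *)
Definition odd_sum n P : R :=
  \sum_(0 <= i < P) ((n%:R - i.*2.+1%:R)^-1 + (n%:R + i.*2.+1%:R)^-1).

Lemma odd_sum_step n P : odd_sum n.+2 P =
  odd_sum n P + ((n.+1%:R + P.*2%:R)^-1 - (n.+1%:R - P.*2%:R)^-1).
Proof.
rewrite /odd_sum; elim: P => [|P IH].
  by rewrite !big_nil add0r subr0 addr0 subrr.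
rewrite !big_nat_recr//= {}IH.
have -> : n.+2%:R - P.*2.+1%:R = n.+1%:R - P.*2%:R :> R by rewrite -!natr1; ring.
have -> : n%:R + P.*2.+1%:R = n.+1%:R + P.*2%:R :> R by rewrite -!natr1; ring.
have -> : n.+2%:R + P.*2.+1%:R = n.+1%:R + P.+1.*2%:R :> R.
  by rewrite doubleS -!natr1; ring.
have -> : n%:R - P.*2.+1%:R = n.+1%:R - P.+1.*2%:R :> R.
  by rewrite doubleS -!natr1; ring.
by ring.
Qed.

Lemma odd_sum0 P : odd_sum 0 P = 0.
Proof. by rewrite /odd_sum big1// => i _; rewrite sub0r add0r invrN addNr. Qed.

Lemma odd_sum1 P : odd_sum 1 P = P.*2%:R^-1.
Proof.
rewrite /odd_sum; elim: P => [|P IH]; first by rewrite big_nil invr0.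
rewrite big_nat_recr//= IH.
have -> : 1 - P.*2.+1%:R = - P.*2%:R :> R by rewrite -natr1; ring.
have -> : 1 + P.*2.+1%:R = P.+1.*2%:R :> R by rewrite doubleS -!natr1; ring.
by rewrite invrN addNKr.
Qed.

Lemma odd_sum_cvg n : odd_sum n @ \oo --> 0.
Proof.
elim/ltn_ind: n => -[_|[_|n IH]].
- by rewrite (_ : odd_sum 0 = fun=> 0); [exact: cvg_cst|apply/funext => P; rewrite odd_sum0].
- rewrite (_ : odd_sum 1 = fun P => (0 + P.*2%:R)^-1); first exact: cvg_inv_double.
  by apply/funext => P; rewrite odd_sum1 add0r.
rewrite (_ : odd_sum n.+2 = fun P => odd_sum n P +
   ((n.+1%:R + P.*2%:R)^-1 + (- n.+1%:R + P.*2%:R)^-1)); last first.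
  by apply/funext => P; rewrite odd_sum_step -invrN opprB addrC [- _ + _]addrC addrC.
have -> : (0 : R) = 0 + (0 + 0) by rewrite !addr0.
apply: cvgD; first by apply: IH; rewrite ltnS.
by apply: cvgD; exact: cvg_inv_double.
Qed.

Lemma sum_odd_delta n P (x : R) :
  \sum_(0 <= i < P) (if n == i.*2.+1 then x else 0) =
  if odd n && (n./2 < P)%N then x else 0.
Proof.
elim: P => [|P IH]; first by rewrite big_nil ltn0 andbF.
rewrite big_nat_recr//= IH ltnS [in RHS]leq_eqVlt.
have [->|nP] := eqVneq n P.*2.+1.
  by rewrite /= odd_double/= uphalf_double ltnn eqxx add0r.
rewrite addr0; case: ifPn => [/andP[-> ->]|]; first by rewrite orbT.
case no : (odd n) => //= nlt; rewrite (negbTE nlt) orbF; case: eqP => // nE.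
by move: nP; rewrite -nE -[X in X == _](odd_double_half n) no eqxx.
Qed.

Lemma sum_odd_delta_cvg n (x : R) :
  (fun P => \sum_(0 <= i < P) (if n == i.*2.+1 then x else 0)) @ \oo -->
  if odd n then x else 0.
Proof.
apply: cvg_near_cst.
by exists n./2.+1 => // P /= nP; rewrite sum_odd_delta nP andbT.
Qed.

(** At n = p the left-hand side is 1/0 = 0, which accounts for the last term. *)
Lemma inv_sqrB_odd_sum n p : (0 < n)%N ->
  (n%:R ^+ 2 - p%:R ^+ 2)^-1 =
  (2 * n%:R)^-1 * ((n%:R - p%:R)^-1 + (n%:R + p%:R)^-1)
  - (if n == p then (4 * n%:R ^+ 2)^-1 else 0) :> R.
Proof.
move=> n0; have nn0 : n%:R != 0 :> R by rewrite pnatr_eq0 -lt0n.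
have [<-|np] := eqVneq n p.
  rewrite !subrr !invr0 add0r (_ : n%:R + n%:R = 2 * n%:R); last by ring.
  by field.
have h1 : n%:R - p%:R != 0 :> R by rewrite subr_eq0 eqr_nat.
have h2 : n%:R + p%:R != 0 :> R by rewrite -natrD pnatr_eq0 addn_eq0 negb_and -lt0n n0.
have -> : n%:R ^+ 2 - p%:R ^+ 2 = (n%:R - p%:R) * (n%:R + p%:R) :> R by ring.
by field; rewrite nn0 h1 h2.
Qed.

(** The sum over p odd, p <> n, of 1/(n^2-p^2). *)
Lemma inv_sqrB_cvg n : (0 < n)%N ->
  (fun P => \sum_(0 <= i < P) (n%:R ^+ 2 - i.*2.+1%:R ^+ 2)^-1) @ \oo -->
  - (if odd n then (4 * n%:R ^+ 2)^-1 else 0 : R).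
Proof.
move=> n0.
rewrite (_ : (fun P => _) = fun P => (2 * n%:R)^-1 * odd_sum n P -
   \sum_(0 <= i < P) (if n == i.*2.+1 then (4 * n%:R ^+ 2)^-1 else 0)); last first.
  apply/funext => P; rewrite /odd_sum mulr_sumr -sumrB; apply: eq_bigr => i _.
  exact: inv_sqrB_odd_sum.
set x : R := - _; have -> : x = (2 * n%:R)^-1 * 0 + x by rewrite mulr0 add0r.
apply: cvgB; last exact: sum_odd_delta_cvg.
by apply: cvgM; [exact: cvg_cst|exact: odd_sum_cvg].
Qed.

Lemma sum_powers_eq (x y : R) M : x != 0 -> y != 0 -> x != y ->
  \sum_(1 <= a < M.+1) x ^- a * y ^- (M.+1 - a) =
  (x ^- M - y ^- M) * (y - x)^-1.
Proof.
move=> x0 y0 xy; have yx : y - x != 0 by rewrite subr_eq0 eq_sym.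
elim: M => [|M IH]; first by rewrite big_nil expr0 subrr mul0r.
rewrite big_nat_recr//= subSnn expr1.
rewrite (eq_big_nat _ _ (F2 := fun a => y^-1 * (x ^- a * y ^- (M.+1 - a)))); last first.
  by move=> a /andP[_ aM]; rewrite subSn ?(ltnW aM)// exprS invfM mulrCA.
rewrite -mulr_sumr IH !exprS.
have : x ^+ M != 0 by rewrite expf_neq0.
have : y ^+ M != 0 by rewrite expf_neq0.
move: (x ^+ M) (y ^+ M) => u v v0 u0; field.
by rewrite x0 y0 u0 v0 yx.
Qed.

Lemma power_partial_fraction n p M : (0 < n)%N -> (0 < p)%N ->
  \sum_(1 <= a < M.+1) p%:R ^- (2 * a) * n%:R ^- (2 * (M.+1 - a)) =
  (p%:R ^- (2 * M) - n%:R ^- (2 * M)) * (n%:R ^+ 2 - p%:R ^+ 2)^-1 +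
  (if n == p then M%:R * n%:R ^- (2 * M.+1) else 0) :> R.
Proof.
move=> n0 p0; have nn0 : n%:R != 0 :> R by rewrite pnatr_eq0 -lt0n.
have pp0 : p%:R != 0 :> R by rewrite pnatr_eq0 -lt0n.
have [<-|np] := eqVneq n p.
  rewrite subrr mul0r add0r.
  rewrite (eq_big_nat _ _ (F2 := fun a => n%:R ^- (2 * M.+1))); last first.
    by move=> a /andP[_ aM]; rewrite -invfM -exprD -mulnDr subnKC// ltnW.
  by rewrite sumr_const_nat subn1 mulr_natl.
rewrite addr0 !exprM -sum_powers_eq ?expf_neq0//; last first.
  rewrite eqrXn2 ?ler0n// eqr_nat eq_sym//.
by apply: eq_bigr => a _; rewrite !exprM.
Qed.

Lemma cvg_odd_zeta s : (2 <= s)%N ->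
  cvgn (series (fun i => i.*2.+1%:R ^- s : R)).
Proof.
move=> s2; apply: series_dominated_cvg cvg_series_inv_sqr => i.
by rewrite ger0_norm ?invr_ge0 ?exprn_ge0// inv_odd_pow_le.
Qed.

(** \sum_(p odd) p^-s, for s >= 2. *)
Definition odd_zeta s : R := limn (series (fun i => i.*2.+1%:R ^- s : R)).

(** The sum of g(n)/(n^2-p^2) over n < N, n <> p. *)
Definition sqr_sum (g : nat -> R) N p : R :=
  \sum_(0 <= n < N) g n * (n%:R ^+ 2 - p%:R ^+ 2)^-1.

(** Two computations of \sum_(p odd) \sum_n g(n) \sum_(a+b=M+1) p^(-2a) n^(-2b), with
    a, b >= 1: as a sum of products, and by [power_partial_fraction].  The sum over
    n is first truncated at N; the sum over p then converges for each N, and the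
    last hypothesis allows N to tend to infinity under the sum over p. *)
Theorem parity_sum (g G V : nat -> R) (B c : R) M :
  g 0 = 0 ->
  (forall b, (1 <= b < M.+1)%N ->
    (fun N => \sum_(0 <= n < N) g n * n%:R ^- (2 * b)) @ \oo --> G b) ->
  (fun N => \sum_(0 <= n < N | odd n) g n * n%:R ^- (2 * M.+1)) @ \oo --> B ->
  (forall i, (fun N => sqr_sum g N i.*2.+1) @ \oo --> V i) ->
  (forall N i, `|i.*2.+1%:R ^- (2 * M) * sqr_sum g N i.*2.+1| <= c * i.+1%:R ^- 2) ->
  series (fun i => i.*2.+1%:R ^- (2 * M) * V i) @ \oo -->
    \sum_(1 <= a < M.+1) odd_zeta (2 * a) * G (M.+1 - a)%N - (M%:R + 1 / 4) * B.
Proof.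
move=> g0 hG hB hV hc.
pose s N := \sum_(1 <= a < M.+1) odd_zeta (2 * a) *
    (\sum_(0 <= n < N) g n * n%:R ^- (2 * (M.+1 - a))) -
  (M%:R + 1 / 4) * \sum_(0 <= n < N | odd n) g n * n%:R ^- (2 * M.+1).
have sE N : s N = \sum_(0 <= n < N) g n *
   (\sum_(1 <= a < M.+1) odd_zeta (2 * a) * n%:R ^- (2 * (M.+1 - a))
    - (n%:R ^- (2 * M) * (if odd n then (4 * n%:R ^+ 2)^-1 else 0)
    + (if odd n then M%:R * n%:R ^- (2 * M.+1) else 0))).
  rewrite /s [X in _ - _ * X]big_mkcond/= mulr_sumr.
  under eq_bigr do rewrite mulr_sumr.
  rewrite exchange_big/= -sumrB; apply: eq_bigr => n _.
  rewrite mulrBr mulr_sumr; congr (_ - _).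
    by apply: eq_bigr => a _; rewrite mulrCA.
  case: ifP => no; last by rewrite !mulr0 addr0 mulr0.
  have nn0 : n%:R != 0 :> R by rewrite pnatr_eq0; case: n no.
  rewrite mulnS exprD.
  have : n%:R ^+ (2 * M) != 0 :> R by rewrite expf_neq0.
  by move: (n%:R ^+ (2 * M)) => x x0; field; rewrite nn0 x0.
have hs N : series (fun i => i.*2.+1%:R ^- (2 * M) * sqr_sum g N i.*2.+1) @ \oo --> s N.
  rewrite (_ : series _ = fun P => \sum_(0 <= n < N) g n *
   (\sum_(1 <= a < M.+1) (\sum_(0 <= i < P) i.*2.+1%:R ^- (2 * a)) * n%:R ^- (2 * (M.+1 - a))
    - (n%:R ^- (2 * M) * - (\sum_(0 <= i < P) (n%:R ^+ 2 - i.*2.+1%:R ^+ 2)^-1)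
    + \sum_(0 <= i < P) (if n == i.*2.+1 then M%:R * n%:R ^- (2 * M.+1) else 0)))); last first.
    apply/funext => P; rewrite /series/=.
    under eq_bigr do rewrite /sqr_sum mulr_sumr.
    rewrite exchange_big/=; apply: eq_big_nat => -[|n] _.
      by rewrite g0 mul0r big1// => i _; rewrite mul0r mulr0.
    under eq_bigr do rewrite mulrCA.
    rewrite -mulr_sumr; congr (_ * _).
    under [X in _ = X - _]eq_bigr do rewrite mulr_suml.
    rewrite exchange_big/= mulrN mulr_sumr opprD opprK addrA -big_split/= -sumrB.
    apply: eq_bigr => i _; rewrite power_partial_fraction//.
    rewrite mulrBl; set x := _ / _; set y := _ / _; set z := if _ then _ else _.
    by move: x y z => x y z; ring.
  rewrite sE; apply: cvg_bigsum => n _ _.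
  case: n => [|n].
    by rewrite g0 mul0r; under eq_fun do rewrite mul0r; exact: cvg_cst.
  apply: cvgM; first exact: cvg_cst.
  apply: cvgB.
    apply: cvg_bigsum => a; rewrite mem_index_iota => /andP[a1 _] _.
    apply: cvgM; last exact: cvg_cst.
    by apply: cvg_odd_zeta; rewrite -[2%N]muln1 leq_mul2l.
  apply: cvgD; last exact: sum_odd_delta_cvg.
  apply: cvgM; first exact: cvg_cst.
  rewrite -[if _ then _ else _]opprK; apply: cvgN.
  exact: inv_sqrB_cvg.
have hh : cvgn (series (fun i => c * i.+1%:R ^- 2)).
  rewrite (_ : (fun i => _) = c *: (fun i => i.+1%:R ^- 2)); last exact/funext.
  by apply: is_cvg_seriesZ; exact: cvg_series_inv_sqr.
have hf i : (fun N => i.*2.+1%:R ^- (2 * M) * sqr_sum g N i.*2.+1) @ \oo -->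
    i.*2.+1%:R ^- (2 * M) * V i by apply: cvgM => //; exact: cvg_cst.
have [gc gl] := tannery hh hc hf hs.
suff <- : limn (series (fun i => i.*2.+1%:R ^- (2 * M) * V i)) =
  \sum_(1 <= a < M.+1) odd_zeta (2 * a) * G (M.+1 - a)%N - (M%:R + 1 / 4) * B by [].
rewrite -(cvg_lim _ gl)//; apply: cvg_lim => //.
apply: cvgB; last by apply: cvgM; [exact: cvg_cst|exact: hB].
apply: cvg_bigsum => a; rewrite mem_index_iota => /andP[a1 aM] _.
apply: cvgM; first exact: cvg_cst.
by apply: hG; rewrite subn_gt0 aM/= ltnS leq_subLR -addn1 addnC leq_add2r.
Qed.

End partial_fractions.

(** * Extension of A and D to negative indices *)

Section reflection.
Context {R : realType}.
Implicit Types (x y : int) (n p i k K N : nat).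

(** Extension of [Aint] to the integers by A_(-p) = - A_(p-1). *)
Definition Az x : R := match x with Posz n => Aint n | Negz n => - Aint n end.

(** At x = -1 both sides are 0, by the convention 1/0 = 0. *)
Lemma Az_rec x : Az x + Az (x + 1) = ((x + 1)%:~R)^-1.
Proof.
case: x => [n|[|n]].
- by rewrite -PoszD addn1 /= Aint_rec.
- by rewrite /= addNr invr0.
- rewrite (_ : Negz n.+1 + 1 = Negz n); last by rewrite !NegzE; lia.
  by rewrite /= -opprD addrC Aint_rec NegzE mulrNz invrN.
Qed.

(** Extension of [Dint] to the integers by D_(-p) = - D_p for p odd and
    D_(-p) = - D_p + (-1)^(p/2) pi/2 for p even. *)
Definition Dz x : R := match x with
  | Posz n => Dint n
  | Negz n => - Dint n.+1 + (if odd n.+1 then 0 else (-1) ^+ n.+1./2 * (pi / 2))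
  end.

Lemma DzN n : Dz (- n%:Z) =
  - Dint n + (if odd n then 0 else (-1) ^+ n./2 * (pi / 2)).
Proof.
case: n => [|n]; last by rewrite -NegzE.
by rewrite oppr0 /= Dint0 mul1r; field.
Qed.

(** At x = -1 both sides are 0, by the convention 1/0 = 0. *)
Lemma Dz_rec x : Dz x + Dz (x + 2) = ((x + 1)%:~R)^-1.
Proof.
case: x => [n|[|n]].
- by rewrite -!PoszD addn2 addn1 /= Dint_rec.
- by rewrite (_ : Negz 0 + 2 = Posz 1)//= addr0 addNr invr0.
- have -> : Negz n.+1 + 2 = - (n%:Z) by rewrite NegzE; lia.
  have -> : Negz n.+1 + 1 = - (n.+1%:Z) by rewrite NegzE; lia.
  rewrite DzN mulrNz invrN -[n.+1%:~R]/(n.+1%:R) -(Dint_rec n) [Dz _]/= negbK.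
  case: (odd n); rewrite ?exprS; ring.
Qed.

Lemma Az_le x : `|Az x| <= 1.
Proof.
have h n : `|Aint n| <= (1 : R).
  rewrite ger0_norm ?Aint_ge0// (le_trans (Aint_le n))//.
  by rewrite invf_le1 ?ltr0n// ler1n.
by case: x => n /=; rewrite ?normrN.
Qed.

Lemma Dz_le x : `|Dz x| <= 1 + pi / 2.
Proof.
have pi0 : 0 <= pi / 2 :> R by rewrite divr_ge0 ?pi_ge0.
have h n : `|Dint n| <= (1 : R).
  rewrite ger0_norm ?Dint_ge0// (le_trans (Dint_le n))//.
  by rewrite invf_le1 ?ltr0n// ler1n.
case: x => n; first by rewrite (le_trans (h n))// lerDl.
rewrite (le_trans (ler_normD _ _))// normrN lerD//.
case: ifP => _; first by rewrite normr0.
by rewrite normrM normrX normrN1 expr1n mul1r ger0_norm.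
Qed.

Lemma Az_cvg x : (fun K => Az (x + K%:Z)) @ \oo --> 0.
Proof.
rewrite -(cvg_shiftn (absz x)); apply: cvg_le0 cvg_invn => K /=.
have [n nE] : exists n, x + (K + absz x)%N%:Z = (K + n)%N%:Z.
  by exists (absz (x + (absz x)%:Z)); lia.
rewrite nE /= ger0_norm ?Aint_ge0// (le_trans (Aint_le _))//.
by rewrite lef_pV2 ?posrE// ler_nat ltnS leq_addr.
Qed.

Lemma Dz_cvg x : (fun K => Dz (x + K%:Z)) @ \oo --> 0.
Proof.
rewrite -(cvg_shiftn (absz x)); apply: cvg_le0 cvg_invn => K /=.
have [n nE] : exists n, x + (K + absz x)%N%:Z = (K + n)%N%:Z.
  by exists (absz (x + (absz x)%:Z)); lia.
rewrite nE /= ger0_norm ?Dint_ge0// (le_trans (Dint_le _))//.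
by rewrite lef_pV2 ?posrE// ler_nat ltnS leq_addr.
Qed.

Lemma Az_partial x K :
  \sum_(0 <= j < K) (-1) ^+ j * ((j.+1%:Z + x)%:~R)^-1 =
  Az x - (-1) ^+ K * Az (x + K%:Z).
Proof.
elim: K => [|K IH]; first by rewrite big_nil addr0 mul1r subrr.
rewrite big_nat_recr//= IH.
have -> : K.+1%:Z + x = x + K%:Z + 1 by lia.
have -> : x + K.+1%:Z = x + K%:Z + 1 by lia.
by rewrite -Az_rec exprS; ring.
Qed.

Lemma Dz_partial x K :
  \sum_(0 <= j < K) (-1) ^+ j * ((j.*2.+1%:Z + x)%:~R)^-1 =
  Dz x - (-1) ^+ K * Dz (x + K.*2%:Z).
Proof.
elim: K => [|K IH]; first by rewrite big_nil addr0 mul1r subrr.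
rewrite big_nat_recr//= IH.
have -> : K.*2.+1%:Z + x = x + K.*2%:Z + 1 by lia.
have -> : x + K.+1.*2%:Z = x + K.*2%:Z + 2 by lia.
by rewrite -Dz_rec exprS; ring.
Qed.

Lemma signr_cvg0 (u : nat -> R) : u @ \oo --> 0 ->
  (fun n => (-1) ^+ n * u n) @ \oo --> 0.
Proof.
move=> u0; have nu : (fun n => `|u n|) @ \oo --> 0 by apply/norm_cvg0P.
by apply: cvg_le0 nu => n; rewrite normrM normrX normrN1 expr1n mul1r.
Qed.

(** The sum of chi(n)/(n+x) over n < N, n <> -x, where chi = [altseq 0]. *)
Definition chi_sum x N : R := \sum_(0 <= n < N) altseq 0 n * ((n%:Z + x)%:~R)^-1.

Lemma chi_sumE x N :
  chi_sum x N = Dz x - (-1) ^+ N./2 * Dz (x + N./2.*2%:Z).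
Proof.
rewrite /chi_sum sum_altseq subn0 -Dz_partial.
by apply: eq_bigr => j _; rewrite addn0.
Qed.

Lemma Dz_tail_cvg x : (fun K => (-1) ^+ K * Dz (x + K.*2%:Z)) @ \oo --> 0.
Proof.
apply: signr_cvg0.
by apply: (cvg_subseq (u := fun K => Dz (x + K%:Z)) cvg_double); exact: Dz_cvg.
Qed.

Lemma chi_sum_cvg x : chi_sum x @ \oo --> Dz x.
Proof.
rewrite (_ : chi_sum x = fun N => Dz x - (-1) ^+ N./2 * Dz (x + N./2.*2%:Z)); last first.
  by apply/funext => N; rewrite chi_sumE.
apply: cvg_cst_sub0.
apply: (@cvg_comp _ _ _ _ (fun K => (-1) ^+ K * Dz (x + K.*2%:Z)) _ \oo).
  by have := cvg_half 0; under eq_fun do rewrite subn0.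
exact: Dz_tail_cvg.
Qed.

Lemma chi_sum_le x N : `|chi_sum x N| <= 2 * (1 + pi / 2).
Proof.
rewrite chi_sumE (le_trans (ler_normB _ _))// normrM normrX normrN1 expr1n mul1r.
by rewrite mulr_natl mulr2n lerD// Dz_le.
Qed.

(** The 4-periodic sequence 0, 2, -4, 2, written as 2 ((-1)^(n-1) - altseq 1 n) for
    n > 0. *)
Definition per4 n : R :=
  2 * ((if n is 0%N then 0 else (-1) ^+ n.-1) - altseq 1 n).

(** The sum of per4(n)/(n+x) over n < N, n <> -x. *)
Definition per4_sum x N : R := \sum_(0 <= n < N) per4 n * ((n%:Z + x)%:~R)^-1.

Lemma per4_sumE x N : per4_sum x N.+1 =
  2 * (Az x - (-1) ^+ N * Az (x + N%:Z)
       - (Dz (x + 1) - (-1) ^+ N./2 * Dz (x + 1 + N./2.*2%:Z))).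
Proof.
rewrite /per4_sum.
transitivity (2 * (\sum_(0 <= n < N.+1) (if n is 0%N then 0 else (-1) ^+ n.-1) *
    ((n%:Z + x)%:~R)^-1 - \sum_(0 <= n < N.+1) altseq 1 n * ((n%:Z + x)%:~R)^-1) : R).
  rewrite -sumrB mulr_sumr; apply: eq_bigr => n _.
  by rewrite /per4 -mulrA mulrBl.
rewrite big_nat_recl// mul0r add0r sum_altseq subn1/= -Az_partial -Dz_partial.
congr (2 * (_ - _)); apply: eq_bigr => j _.
by congr (_ * (_%:~R)^-1); lia.
Qed.

Lemma per4_sum_cvg x : per4_sum x @ \oo --> 2 * (Az x - Dz (x + 1)).
Proof.
rewrite -cvg_shiftS.
rewrite (_ : (fun _ => _) = fun N => 2 * (Az x - (-1) ^+ N * Az (x + N%:Z)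
       - (Dz (x + 1) - (-1) ^+ N./2 * Dz (x + 1 + N./2.*2%:Z)))); last first.
  by apply/funext => N; rewrite per4_sumE.
apply: cvgM; first exact: cvg_cst.
apply: cvgB; apply: cvg_cst_sub0; first by apply: signr_cvg0; exact: Az_cvg.
apply: (@cvg_comp _ _ _ _ (fun K => (-1) ^+ K * Dz (x + 1 + K.*2%:Z)) _ \oo).
  by have := cvg_half 0; under eq_fun do rewrite subn0.
exact: Dz_tail_cvg.
Qed.

Lemma per4_sum_le x N : `|per4_sum x N| <= 2 * (2 + 2 * (1 + pi / 2)).
Proof.
have pi0 : 0 <= pi / 2 :> R by rewrite divr_ge0 ?pi_ge0.
case: N => [|N]; first by rewrite /per4_sum big_nil normr0; lra.
rewrite per4_sumE normrM (ger0_norm (_ : 0 <= 2))// ler_pM2l//.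
rewrite (le_trans (ler_normB _ _))// lerD//.
  rewrite (le_trans (ler_normB _ _))// normrM normrX normrN1 expr1n mul1r.
  by rewrite -[2]/(1 + 1) lerD// Az_le.
rewrite (le_trans (ler_normB _ _))// normrM normrX normrN1 expr1n mul1r.
by rewrite mulr_natl mulr2n lerD// Dz_le.
Qed.

(** 1/2 - 1/4 + 1/6 - ... is one half of 1 - 1/2 + 1/3 - ... *)
Lemma Dint1 : Dint 1 = ln 2 / 2 :> R.
Proof.
have h1 : (fun K => \sum_(0 <= j < K) (-1) ^+ j * (j.*2 + 1).+1%:R^-1) @ \oo --> (Dint 1 : R).
  rewrite (_ : (fun K => _) = fun K => Dint 1 - (-1) ^+ K * Dz (1 + K.*2%:Z)).
    by apply: cvg_cst_sub0; exact: Dz_tail_cvg.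
  by apply/funext => K; rewrite Dint_partial.
have h2 : (fun K => \sum_(0 <= j < K) (-1) ^+ j * (j.*2 + 1).+1%:R^-1) @ \oo -->
    (ln 2 / 2 : R).
  rewrite (_ : (fun K => _) = fun K => (Aint 0 - (-1) ^+ K * Az (0 + K%:Z)) / 2).
    apply: cvgM; last exact: cvg_cst.
    by rewrite -Aint0; apply: cvg_cst_sub0; apply: signr_cvg0; exact: Az_cvg.
  apply/funext => K; rewrite -[Aint 0]/(Az 0) -Az_partial mulr_suml.
  apply: eq_bigr => j _; rewrite addr0 -mulrA -invfM; congr (_ * _^-1).
  by rewrite addn1 -doubleS -muln2 natrM.
by rewrite -(cvg_lim _ h1)// (cvg_lim _ h2).
Qed.

End reflection.

(** * Zeta and beta values as limits of finite sums *)

Section dirichlet_series.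
Context {R : realType}.
Implicit Types (n p i k K N s : nat).

(** The partial sums of the zeta series. *)
Definition zeta_sum s N : R := \sum_(1 <= n < N) n%:R ^- s.

Lemma cvg_predn : (fun N => N.-1) @ \oo --> \oo.
Proof.
move=> A [M _ hM]; exists M.+1 => // N /= MN; apply: hM => /=.
by case: N MN.
Qed.

Lemma zeta_sumE s N : zeta_sum s N = series (fun i => i.+1%:R ^- s) N.-1.
Proof.
rewrite /zeta_sum /series/= big_add1.
by case: N => [|N] //=; rewrite !big_nil.
Qed.

Lemma zeta_sum_cvg s : (2 <= s)%N -> zeta_sum s @ \oo --> riemann_zeta R s.
Proof.
move=> s2.
have hc : cvgn (series (fun i => i.+1%:R ^- s : R)).
  apply: series_dominated_cvg cvg_series_inv_sqr => i.
  rewrite ger0_norm ?invr_ge0 ?exprn_ge0// lef_pV2 ?posrE ?exprn_gt0//.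
  by rewrite ler_weXn2l// ler1n.
have h : zeta_sum s @ \oo --> limn (series (fun i => i.+1%:R ^- s : R)).
  rewrite (_ : zeta_sum s = fun N => series (fun i => i.+1%:R ^- s : R) N.-1); last first.
    by apply/funext => N; rewrite zeta_sumE.
  by apply: cvg_subseq hc; exact: cvg_predn.
suff -> : riemann_zeta R s = limn (series (fun i => i.+1%:R ^- s : R)) by [].
exact: (cvg_lim _ h).
Qed.

Lemma zeta_sum_comp_cvg s (f : nat -> nat) : (2 <= s)%N -> f @ \oo --> \oo ->
  (fun N => zeta_sum s (f N)) @ \oo --> riemann_zeta R s.
Proof.
by move=> s2 hf; apply: cvg_subseq hf _; exact: zeta_sum_cvg.
Qed.

Lemma sum0S (u : nat -> R) n :
  \sum_(0 <= i < n.+1) u i = \sum_(0 <= i < n) u i + u n.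
Proof. by rewrite big_nat_recr. Qed.

Lemma sum1S (u : nat -> R) n :
  \sum_(1 <= i < n.+2) u i = \sum_(1 <= i < n.+1) u i + u n.+1.
Proof. by rewrite big_nat_recr. Qed.

(** Splitting the terms by the parity of n. *)
Lemma zeta_sum_double s P : zeta_sum s P.*2.+1 =
  series (fun i => i.*2.+1%:R ^- s) P + 2 ^- s * zeta_sum s P.+1.
Proof.
rewrite /zeta_sum /series/=; elim: P => [|P IH].
  by rewrite !big_geq// mulr0 addr0.
pose h n : R := n%:R ^- s.
rewrite doubleS (sum1S h P.*2.+1) (sum1S h P.*2) IH (sum0S (fun i => i.*2.+1%:R ^- s)).
rewrite (sum1S h P) /h -[P.*2.+2]doubleS -[P.+1.*2]mul2n natrM exprMn invfM.
by move: (\sum_(0 <= k < P) _) (\sum_(1 <= k < P.+1) _) => x y; ring.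
Qed.

Lemma cvg_succn : (fun P => P.+1) @ \oo --> \oo.
Proof. by move=> A [M _ hM]; exists M => // N /= MN; apply: hM => /=; exact: ltnW. Qed.

Lemma cvg_doubleS : (fun P => P.*2.+1) @ \oo --> \oo.
Proof.
move=> A [M _ hM]; exists M => // N /= MN; apply: hM => /=.
by rewrite (leq_trans MN)// -addnn -addnS leq_addr.
Qed.

Lemma odd_zetaE s : (2 <= s)%N -> odd_zeta s = (1 - 2 ^- s) * riemann_zeta R s.
Proof.
move=> s2; apply: cvg_lim => //.
rewrite (_ : series _ = fun P => zeta_sum s P.*2.+1 - 2 ^- s * zeta_sum s P.+1); last first.
  by apply/funext => P; rewrite zeta_sum_double addrK.
rewrite mulrBl mul1r; apply: cvgB; first exact: zeta_sum_comp_cvg cvg_doubleS.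
by apply: cvgM; [exact: cvg_cst|exact: zeta_sum_comp_cvg cvg_succn].
Qed.

Lemma per4_values K : [/\ per4 K.*2.*2.+1 = 2 :> R, per4 K.*2.*2.+2 = - 4 :> R,
  per4 K.*2.*2.+3 = 2 :> R & per4 K.*2.*2.+4 = 0 :> R].
Proof.
have sgn n : (-1) ^+ n.*2 = 1 :> R by rewrite -signr_odd odd_double.
rewrite /per4 /altseq !subn1/= !odd_double/= ?uphalf_double ?exprS ?sgn.
by split; ring.
Qed.

(** per4(n) is 2 - 6 [2 divides n] + 4 [4 divides n] for n > 0. *)
Lemma per4_sum_zeta s K : \sum_(0 <= n < K.*2.*2.+1) per4 n * n%:R ^- s =
  2 * zeta_sum s K.*2.*2.+1 - 6 * 2 ^- s * zeta_sum s K.*2.+1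
  + 4 * 4 ^- s * zeta_sum s K.+1.
Proof.
rewrite /zeta_sum; elim: K => [|K IH].
  by rewrite big_nat1 !big_geq// /per4 /altseq /= !subrr !mulr0 mul0r subrr addr0.
pose f n : R := per4 n * n%:R ^- s; pose h n : R := n%:R ^- s.
rewrite !doubleS 4!(sum0S f) -/f {}IH.
rewrite [\sum_(1 <= n < K.*2.*2.+4.+1) _](_ : _ = \sum_(1 <= n < K.*2.*2.+1) h n +
  h K.*2.*2.+1 + h K.*2.*2.+2 + h K.*2.*2.+3 + h K.*2.*2.+4); last by rewrite !(sum1S h).
rewrite [\sum_(1 <= n < K.*2.+3) _](_ : _ = \sum_(1 <= n < K.*2.+1) h n +
  h K.*2.+1 + h K.*2.+2); last by rewrite !(sum1S h).
rewrite [\sum_(1 <= n < K.+2) _](_ : _ = \sum_(1 <= n < K.+1) h n + h K.+1);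
  last by rewrite (sum1S h).
rewrite /f /h.
have [-> -> -> ->] := per4_values K.
have e1 : K.*2.*2.+2%:R ^- s = 2 ^- s * K.*2.+1%:R ^- s :> R.
  by rewrite -invfM -exprMn -natrM; congr (_%:R ^- s); lia.
have e2 : K.*2.*2.+4%:R ^- s = 2 ^- s * K.*2.+2%:R ^- s :> R.
  by rewrite -invfM -exprMn -natrM; congr (_%:R ^- s); lia.
have e3 : 4 ^- s * K.+1%:R ^- s = 2 ^- s * K.*2.+2%:R ^- s :> R.
  by rewrite -!invfM -!exprMn -!natrM; congr (_%:R ^- s); lia.
rewrite e1 e2; move: e3.
move: (\sum_(1 <= n < K.*2.*2.+1) _) (\sum_(1 <= n < K.*2.+1) _)
  (\sum_(1 <= n < K.+1) _) (K.*2.*2.+1%:R ^- s) (K.*2.*2.+3%:R ^- s)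
  (K.*2.+1%:R ^- s) (K.*2.+2%:R ^- s) (2 ^- s) (4 ^- s) (K.+1%:R ^- s).
move=> z4 z2 z1 h1 h3 g1 g2 t r k e3.
have -> : 4 * r * (z1 + k) = 4 * r * z1 + 4 * (r * k) by ring.
by rewrite e3; ring.
Qed.

Lemma per4_le n : `|per4 n| <= 4 :> R.
Proof.
rewrite /per4 normrM (ger0_norm (_ : 0 <= 2))//.
have : `|(if n is 0%N then 0 else (-1) ^+ n.-1) - altseq 1 n| <= 1 + 1 :> R.
  rewrite (le_trans (ler_normB _ _))// lerD ?altseq_le1//.
  by case: n => [|n]; rewrite ?normr0// normrX normrN1 expr1n.
by lra.
Qed.

(** The series converges absolutely, so its sum is the limit along N = 4K+1. *)
Lemma per4_zeta_cvg s : (2 <= s)%N ->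
  (fun N => \sum_(0 <= n < N) per4 n * n%:R ^- s) @ \oo -->
  (2 - 6 * 2 ^- s + 4 * 4 ^- s) * riemann_zeta R s.
Proof.
move=> s2.
have hz : cvgn (series (fun n => 4 * n%:R ^- s : R)).
  apply/cvg_ex; exists (4 * riemann_zeta R s).
  rewrite (_ : series _ = fun N => 4 * zeta_sum s N).
    by apply: cvgM; [exact: cvg_cst|exact: zeta_sum_cvg].
  apply/funext => N; rewrite /series/= /zeta_sum mulr_sumr.
  case: N => [|N]; first by rewrite !big_geq.
  by rewrite big_ltn// expr0n; case: s s2 => //= s _; rewrite invr0 mulr0 add0r.
have hc : cvgn (series (fun n => per4 n * n%:R ^- s : R)).
  apply: series_dominated_cvg hz => n.
  rewrite normrM [X in _ * X]ger0_norm ?invr_ge0 ?exprn_ge0//.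
  by rewrite ler_wpM2r ?per4_le ?invr_ge0 ?exprn_ge0.
suff <- : limn (series (fun n => per4 n * n%:R ^- s : R)) =
  (2 - 6 * 2 ^- s + 4 * 4 ^- s) * riemann_zeta R s by [].
have h4 : (fun K => K.*2.*2.+1) @ \oo --> \oo.
  move=> A [M _ hM]; exists M => // N /= MN; apply: hM => /=.
  by rewrite (leq_trans MN)// -addnn -addnS -addnn -addnA leq_addr.
have := cvg_subseq h4 hc => /(cvg_lim _) <- //.
apply: cvg_lim => //.
rewrite (_ : (fun K => _) = fun K => 2 * zeta_sum s K.*2.*2.+1
  - 6 * 2 ^- s * zeta_sum s K.*2.+1 + 4 * 4 ^- s * zeta_sum s K.+1); last first.
  by apply/funext => K; rewrite -per4_sum_zeta.
have -> : (2 - 6 * 2 ^- s + 4 * 4 ^- s) * riemann_zeta R s =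
  2 * riemann_zeta R s - 6 * 2 ^- s * riemann_zeta R s
  + 4 * 4 ^- s * riemann_zeta R s by ring.
apply: cvgD; first apply: cvgB.
- by apply: cvgM; [exact: cvg_cst|exact: zeta_sum_comp_cvg h4].
- by apply: cvgM; [exact: cvg_cst|exact: zeta_sum_comp_cvg cvg_doubleS].
- by apply: cvgM; [exact: cvg_cst|exact: zeta_sum_comp_cvg cvg_succn].
Qed.

Lemma beta_series s : (2 <= s)%N ->
  series (fun j => (-1) ^+ j * j.*2.+1%:R ^- s : R) @ \oo --> dirichlet_beta R s.
Proof.
move=> s2.
set b := fun j => (-1) ^+ j * j.*2.+1%:R ^- s : R.
have hc : cvgn (series b).
  apply: series_dominated_cvg (cvg_odd_zeta s2) => j.
  by rewrite normrM normrX normrN1 expr1n mul1r ger0_norm ?invr_ge0 ?exprn_ge0.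
suff -> : dirichlet_beta R s = limn (series b) by [].
apply: cvg_lim => //.
rewrite (_ : (fun N => _) = fun N => series b N.-1).
  by apply: cvg_subseq hc; exact: cvg_predn.
apply/funext => N; rewrite /series/= big_add1.
case: N => [|N] /=; first by rewrite !big_geq.
apply: eq_bigr => j _; rewrite /b subn1/=; congr (_ * _%:R ^- s).
by rewrite mul2n doubleS subn1.
Qed.

Lemma beta_cvg s : (2 <= s)%N ->
  (fun N => \sum_(0 <= n < N) altseq 0 n * n%:R ^- s) @ \oo --> dirichlet_beta R s.
Proof.
move=> s2; set b := fun j => (-1) ^+ j * j.*2.+1%:R ^- s : R.
rewrite (_ : (fun N => _) = fun N => series b (N - 0)./2).
  by apply: cvg_subseq (beta_series s2); exact: cvg_half.
by apply/funext => N; rewrite sum_altseq; apply: eq_bigr => j _; rewrite addn0.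
Qed.

Lemma sum_odd (F : nat -> R) N :
  \sum_(0 <= n < N | odd n) F n = \sum_(0 <= i < N./2) F i.*2.+1.
Proof.
elim: N => [|N IH]; first by rewrite !big_nil.
rewrite big_mkcond big_nat_recr//= -big_mkcond/= IH uphalf_half.
case no : (odd N); last by rewrite addr0.
by rewrite add1n big_nat_recr//= -[in F N](odd_double_half N) no.
Qed.

Lemma sum_antidiagonal (F : nat -> nat -> R) m :
  \sum_(1 <= a < m.+1) \sum_(1 <= b < m.+1 | (a + b)%N == m) F a b =
  \sum_(1 <= a < m) F a (m - a)%N.
Proof.
case: m => [|m]; first by rewrite !big_geq.
rewrite big_nat_recr//= [X in _ + X]big_nat_cond [X in _ + X]big1 ?addr0; last first.
  move=> b /andP[/andP[b1 _]]; rewrite -{2}[m.+1]addn0 eqn_add2l => /eqP b0.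
  by rewrite b0 in b1.
apply: eq_big_nat => a /andP[a1 am].
rewrite (eq_bigl (fun b => b == (m.+1 - a)%N)) => [|b].
  by rewrite big_nat1_eq subn_gt0 am ltnS leq_subr.
by apply/eqP/eqP; lia.
Qed.

End dirichlet_series.

(** * Evaluation of the single series *)

Section evaluations.
Context {R : realType}.
Implicit Types (n p i k K N s m : nat).

Lemma sum_nat_delta n N (x : R) :
  \sum_(0 <= k < N) (if k == n then x else 0) = if (n < N)%N then x else 0.
Proof. by rewrite -big_mkcond big_nat1_eq. Qed.

Lemma cvg_delta n (x : R) : (fun N => if (n < N)%N then x else 0) @ \oo --> x.
Proof. by apply: cvg_near_cst; exists n.+1 => // N /= ->. Qed.

Lemma altseq0_odd i : altseq 0 i.*2.+1 = (-1) ^+ i :> R.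
Proof. by rewrite /altseq subn0 /= odd_double /= uphalf_double. Qed.

Lemma per4_odd i : per4 i.*2.+1 = 2 :> R.
Proof. by rewrite /per4 /altseq subn1 /= odd_double -signr_odd odd_double; ring. Qed.

Lemma inv_sqrBl n p : (0 < p)%N ->
  (n%:R ^+ 2 - p%:R ^+ 2)^-1 =
  (2 * p%:R)^-1 * (((n%:Z - p%:Z)%:~R)^-1 - ((n%:Z + p%:Z)%:~R)^-1)
  + (if n == p then (4 * p%:R ^+ 2)^-1 else 0) :> R.
Proof.
move=> p0; rewrite intrB intrD -!pmulrn.
have pp0 : p%:R != 0 :> R by rewrite pnatr_eq0 -lt0n.
have [->|np] := eqVneq n p.
  rewrite !subrr invr0 sub0r (_ : p%:R + p%:R = 2 * p%:R :> R); last by ring.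
  by move: (p%:R : R) pp0 => x x0; field.
have h1 : n%:R - p%:R != 0 :> R by rewrite subr_eq0 eqr_nat.
have h2 : n%:R + p%:R != 0 :> R by rewrite -natrD pnatr_eq0 addn_eq0 negb_and -!lt0n p0 orbT.
have -> : n%:R ^+ 2 - p%:R ^+ 2 = (n%:R - p%:R) * (n%:R + p%:R) :> R by ring.
move: (n%:R : R) (p%:R : R) pp0 h1 h2 => x y y0 h1 h2.
by field; rewrite y0 h1 h2.
Qed.

Lemma sqr_sum_chiE N p : (0 < p)%N -> sqr_sum (altseq 0) N p =
  (2 * p%:R)^-1 * (chi_sum (- p%:Z) N - chi_sum p%:Z N)
  + (if (p < N)%N then altseq 0 p * (4 * p%:R ^+ 2)^-1 else 0) :> R.
Proof.
move=> p0; rewrite /sqr_sum -sum_nat_delta /chi_sum -sumrB mulr_sumr -big_split/=.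
apply: eq_bigr => n _; rewrite inv_sqrBl// mulrDr -mulrBr mulrCA; congr (_ + _).
by case: eqP => [->|]; rewrite ?mulr0.
Qed.

(** The limit of [sqr_sum_chiE] for p = 2i+1, where D_(-p) = - D_p. *)
Lemma sqr_sum_chi_cvg i : (fun N => sqr_sum (altseq 0) N i.*2.+1) @ \oo -->
  ((-1) ^+ i / (4 * i.*2.+1%:R ^+ 2) - Dint i.*2.+1 / i.*2.+1%:R : R).
Proof.
have -> : (-1) ^+ i / (4 * i.*2.+1%:R ^+ 2) - Dint i.*2.+1 / i.*2.+1%:R =
  (2 * i.*2.+1%:R)^-1 * (Dz (- i.*2.+1%:Z) - Dz i.*2.+1%:Z)
  + altseq 0 i.*2.+1 * (4 * i.*2.+1%:R ^+ 2)^-1 :> R.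
  rewrite DzN altseq0_odd /= odd_double/= addr0.
  have : i.*2.+1%:R != 0 :> R by rewrite pnatr_eq0.
  by move: (i.*2.+1%:R : R) => x x0; field.
rewrite (_ : (fun N => _) = fun N =>
  (2 * i.*2.+1%:R)^-1 * (chi_sum (- i.*2.+1%:Z) N - chi_sum i.*2.+1%:Z N)
  + (if (i.*2.+1 < N)%N then altseq 0 i.*2.+1 * (4 * i.*2.+1%:R ^+ 2)^-1 else 0)).
  apply: cvgD; last exact: cvg_delta.
  by apply: cvgM; [exact: cvg_cst|apply: cvgB; exact: chi_sum_cvg].
by apply/funext => N; rewrite sqr_sum_chiE.
Qed.

Lemma inv_odd_le1 i : 0 <= (i.*2.+1%:R^-1 : R) <= 1.
Proof. by rewrite invr_ge0 ler0n invf_le1 ?ltr0n// ler1n. Qed.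

Lemma sqr_sum_chi_le N i : `|sqr_sum (altseq 0) N i.*2.+1| <=
  2 * (1 + pi / 2) + 2 * (1 + pi / 2) + 1 :> R.
Proof.
rewrite sqr_sum_chiE// (le_trans (ler_normD _ _))// lerD//.
  apply: (@le_trans _ _ `|chi_sum (- i.*2.+1%:Z) N - chi_sum i.*2.+1%:Z N|); last first.
    exact: le_trans (ler_normB _ _) (lerD (chi_sum_le _ _) (chi_sum_le _ _)).
  rewrite normrM ler_piMl// ger0_norm ?invr_ge0 ?mulr_ge0// invf_le1 ?mulr_gt0 ?ltr0n//.
  by rewrite -natrM ler1n muln_gt0.
case: ifP => _; last by rewrite normr0.
have x1 : 1 <= 4 * i.*2.+1%:R ^+ 2 :> R.
  have : 1 <= i.*2.+1%:R ^+ 2 :> R by rewrite exprn_ege1// ler1n.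
  by lra.
have x0 := lt_le_trans ltr01 x1.
rewrite normrM mulr_ile1 ?altseq_le1// ger0_norm ?invr_ge0 ?(ltW x0)//.
by rewrite invf_le1.
Qed.

Lemma double_ge2 k : (1 <= k)%N -> (2 <= 2 * k)%N.
Proof. by case: k => // k _; rewrite mulnS. Qed.

(** [parity_sum] for g = chi and M = m. *)
Lemma Dint_series m : (1 <= m)%N ->
  series (fun i => i.*2.+1%:R ^- (2 * m).+1 * Dint i.*2.+1 : R) @ \oo -->
  (m%:R + 1 / 2) * dirichlet_beta R (2 * m.+1)
  - \sum_(1 <= a < m.+1) odd_zeta (2 * a) * dirichlet_beta R (2 * (m.+1 - a)).
Proof.
move=> m1.
have hb k : (1 <= k)%N ->
    (fun N => \sum_(0 <= n < N) altseq 0 n * n%:R ^- (2 * k)) @ \oo -->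
    dirichlet_beta R (2 * k).
  by move=> k1; apply: beta_cvg; exact: double_ge2.
have hB : (fun N => \sum_(0 <= n < N | odd n) altseq 0 n * n%:R ^- (2 * m.+1)) @ \oo -->
    dirichlet_beta R (2 * m.+1).
  rewrite (_ : (fun N => _) = fun N => \sum_(0 <= n < N) altseq 0 n * n%:R ^- (2 * m.+1)).
    exact: hb.
  apply/funext => N; rewrite big_mkcond; apply: eq_bigr => n _.
  by case: ifPn => // no; rewrite altseq_parity ?mul0r// (negbTE no).
have h := parity_sum (altseq0 0) (fun b => fun hb' => hb b (andP hb').1) hB sqr_sum_chi_cvg.
have {}h := h (2 * (1 + pi / 2) + 2 * (1 + pi / 2) + 1).
have {h} h : series (fun i => i.*2.+1%:R ^- (2 * m) *
    ((-1) ^+ i / (4 * i.*2.+1%:R ^+ 2) - Dint i.*2.+1 / i.*2.+1%:R) : R) @ \oo -->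
    \sum_(1 <= a < m.+1) odd_zeta (2 * a) * dirichlet_beta R (2 * (m.+1 - a)) -
    (m%:R + 1 / 4) * dirichlet_beta R (2 * m.+1).
  apply: h => N i; rewrite normrM mulrC ler_pM ?sqr_sum_chi_le//.
  by rewrite ger0_norm ?invr_ge0 ?exprn_ge0// inv_odd_pow_le// double_ge2.
have hbeta : series (fun i => (-1) ^+ i * i.*2.+1%:R ^- (2 * m.+1) : R) @ \oo -->
    dirichlet_beta R (2 * m.+1) by apply: beta_series; exact: double_ge2.
have -> : (m%:R + 1 / 2) * dirichlet_beta R (2 * m.+1)
  - \sum_(1 <= a < m.+1) odd_zeta (2 * a) * dirichlet_beta R (2 * (m.+1 - a)) =
  1 / 4 * dirichlet_beta R (2 * m.+1) -
  (\sum_(1 <= a < m.+1) odd_zeta (2 * a) * dirichlet_beta R (2 * (m.+1 - a)) -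
    (m%:R + 1 / 4) * dirichlet_beta R (2 * m.+1)).
  by move: (\sum_(1 <= a < m.+1) _) => S; field.
rewrite (_ : series _ = fun K =>
   1 / 4 * series (fun i => (-1) ^+ i * i.*2.+1%:R ^- (2 * m.+1) : R) K -
   series (fun i => i.*2.+1%:R ^- (2 * m) *
    ((-1) ^+ i / (4 * i.*2.+1%:R ^+ 2) - Dint i.*2.+1 / i.*2.+1%:R) : R) K).
  by apply: cvgB => //; apply: cvgM => //; exact: cvg_cst.
apply/funext => K; rewrite /series/= mulr_sumr -sumrB; apply: eq_bigr => i _.
rewrite mulnS exprD exprS.
have : i.*2.+1%:R != 0 :> R by rewrite pnatr_eq0.
move: (i.*2.+1%:R : R) => x x0.
have : x ^+ (2 * m) != 0 by rewrite expf_neq0.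
by move: (x ^+ (2 * m)) => y y0; field; rewrite x0 y0.
Qed.

(** The sequence n |-> per4(n)/n, to which the double series for S is attached. *)
Definition per4_quot n : R := per4 n / n%:R.

Lemma per4_0 : per4 0 = 0 :> R.
Proof. by rewrite /per4 /altseq /= subrr mulr0. Qed.

Lemma per4_quot_inv n p : (0 < p)%N ->
  per4_quot n * (n%:R ^+ 2 - p%:R ^+ 2)^-1 =
  p%:R ^- 2 * (per4 n * (((n%:Z - p%:Z)%:~R)^-1 + ((n%:Z + p%:Z)%:~R)^-1) / 2
   - per4 n * ((n%:Z + 0)%:~R)^-1
   + (if n == p then per4 p * 3 / (4 * p%:R) else 0)).
Proof.
move=> p0; rewrite /per4_quot addr0.
case: n => [|n].
  by rewrite per4_0 !mul0r subrr add0r; case: p p0 => // p _; rewrite mulr0.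
rewrite intrB intrD -!pmulrn.
have pp0 : p%:R != 0 :> R by rewrite pnatr_eq0 -lt0n.
have nn0 : n.+1%:R != 0 :> R by rewrite pnatr_eq0.
have [<-|np] := eqVneq n.+1 p.
  rewrite !subrr invr0 mulr0 add0r.
  have -> : n.+1%:R + n.+1%:R = 2 * n.+1%:R :> R by ring.
  by move: (n.+1%:R : R) nn0 => x x0; field.
have h1 : n.+1%:R - p%:R != 0 :> R by rewrite subr_eq0 eqr_nat.
have h2 : n.+1%:R + p%:R != 0 :> R by rewrite -natrD pnatr_eq0.
have -> : n.+1%:R ^+ 2 - p%:R ^+ 2 = (n.+1%:R - p%:R) * (n.+1%:R + p%:R) :> R by ring.
move: (n.+1%:R : R) (p%:R : R) nn0 pp0 h1 h2 => x y x0 y0 h1 h2.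
by field; rewrite x0 y0 h1 h2.
Qed.

Lemma sqr_sum_per4E N p : (0 < p)%N -> sqr_sum per4_quot N p =
  p%:R ^- 2 * ((per4_sum (- p%:Z) N + per4_sum p%:Z N) / 2 - per4_sum 0 N
  + (if (p < N)%N then per4 p * 3 / (4 * p%:R) else 0)).
Proof.
move=> p0; rewrite /sqr_sum -sum_nat_delta /per4_sum -big_split/= mulr_suml.
rewrite -sumrB -big_split/=.
rewrite mulr_sumr; apply: eq_bigr => n _; rewrite per4_quot_inv//.
by rewrite [per4 n * (_ + _)]mulrDr.
Qed.

(** With p = 2i+1: A_(-p) = A_p - 1/p and D_(1-p) = D_(p+1) - 1/p + (-1)^i pi/2. *)
Lemma sqr_sum_per4_cvg i : (fun N => sqr_sum per4_quot N i.*2.+1) @ \oo -->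
  i.*2.+1%:R ^- 2 * (2 * (Aint i.*2.+1 - Dint i.*2.+2) - (-1) ^+ i * (pi / 2)
   - ln 2 + 3 / (2 * i.*2.+1%:R)).
Proof.
have x0 : i.*2.+1%:R != 0 :> R by rewrite pnatr_eq0.
have -> : 2 * (Aint i.*2.+1 - Dint i.*2.+2) - (-1) ^+ i * (pi / 2)
   - ln 2 + 3 / (2 * i.*2.+1%:R) =
  (2 * (Az (- i.*2.+1%:Z) - Dz (- i.*2.+1%:Z + 1))
    + 2 * (Az i.*2.+1%:Z - Dz (i.*2.+1%:Z + 1))) / 2
   - 2 * (Az 0 - Dz (0 + 1)) + per4 i.*2.+1 * 3 / (4 * i.*2.+1%:R) :> R.
  rewrite per4_odd -NegzE (_ : Negz i.*2 + 1 = - (i.*2%:Z)); last by rewrite NegzE; lia.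
  rewrite DzN odd_double doubleK -PoszD addn1 add0r [Az _]/= [Dz 1]/= [Dz (Posz _)]/= Dint1.
  have -> : Az 0 = ln 2 :> R by rewrite /= Aint0.
  have hA : Aint i.*2 = i.*2.+1%:R^-1 - Aint i.*2.+1 :> R by rewrite -Aint_rec addrK.
  have hD : Dint i.*2 = i.*2.+1%:R^-1 - Dint i.*2.+2 :> R by rewrite -Dint_rec addrK.
  rewrite hA hD [Az _]/=.
  by move: (i.*2.+1%:R : R) x0 => x x0; field.
rewrite (_ : (fun N => _) = fun N => i.*2.+1%:R ^- 2 *
  ((per4_sum (- i.*2.+1%:Z) N + per4_sum i.*2.+1%:Z N) / 2 - per4_sum 0 N
  + (if (i.*2.+1 < N)%N then per4 i.*2.+1 * 3 / (4 * i.*2.+1%:R) else 0))); last first.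
  by apply/funext => N; rewrite sqr_sum_per4E.
apply: cvgM; first exact: cvg_cst.
apply: cvgD; last exact: cvg_delta.
apply: cvgB; last exact: per4_sum_cvg.
apply: cvgM; last exact: cvg_cst.
by apply: cvgD; exact: per4_sum_cvg.
Qed.

Lemma sqr_sum_per4_le N i : `|i.*2.+1%:R ^+ 2 * sqr_sum per4_quot N i.*2.+1| <=
  2 * (2 * (2 + 2 * (1 + pi / 2))) + 2 :> R.
Proof.
have x0 : i.*2.+1%:R ^+ 2 != 0 :> R by rewrite expf_neq0// pnatr_eq0.
rewrite sqr_sum_per4E// mulVKf//.
have := @per4_sum_le R (- i.*2.+1%:Z) N; have := @per4_sum_le R (i.*2.+1%:Z) N.
have := @per4_sum_le R 0 N.
rewrite !ler_norml; move: (per4_sum _ _) (per4_sum _ _) (per4_sum _ _) => a b c.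
set C := 2 * _ => /andP[a1 a2] /andP[b1 b2] /andP[c1 c2].
set d := if _ then _ else _.
have [d0 d2] : 0 <= d /\ d <= 2.
  rewrite /d; case: ifP => _; last by split.
  rewrite per4_odd; have /andP[y0 y1] := inv_odd_le1 i.
  rewrite invfM; move: (i.*2.+1%:R^-1) y0 y1 => y y0 y1; split; lra.
by apply/andP; split; lra.
Qed.

(** [parity_sum] for g(n) = per4(n)/n and M = m - 1. *)
Lemma tail_series m : (1 <= m)%N ->
  series (fun i => i.*2.+1%:R ^- (2 * m) * (Aint i.*2.+1 - Dint i.*2.+2) : R) @ \oo -->
  (\sum_(1 <= a < m) odd_zeta (2 * a) *
     ((4 ^- (2 * (m - a)) - 3 * 2 ^- (2 * (m - a)) + 2) * riemann_zeta R (2 * (m - a) + 1)))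
   / 2 - m%:R * odd_zeta (2 * m + 1) + pi / 4 * dirichlet_beta R (2 * m)
   + ln 2 / 2 * odd_zeta (2 * m).
Proof.
case: m => // M _; set m := M.+1.
pose G b := (4 ^- (2 * b) - 3 * 2 ^- (2 * b) + 2) * riemann_zeta R (2 * b + 1).
have hG b : (1 <= b < M.+1)%N ->
   (fun N => \sum_(0 <= n < N) per4_quot n * n%:R ^- (2 * b)) @ \oo --> G b.
  move=> /andP[b1 _].
  have -> : G b = (2 - 6 * 2 ^- (2 * b + 1) + 4 * 4 ^- (2 * b + 1)) *
      riemann_zeta R (2 * b + 1).
    rewrite /G; congr (_ * _); rewrite addn1 !exprS.
    have : (2 : R) ^+ (2 * b) != 0 by rewrite expf_neq0.
    have : (4 : R) ^+ (2 * b) != 0 by rewrite expf_neq0.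
    by move: (2 ^+ (2 * b)) (4 ^+ (2 * b)) => x y y0 x0; field; rewrite x0 y0.
  rewrite (_ : (fun N => _) = fun N => \sum_(0 <= n < N) per4 n * n%:R ^- (2 * b + 1)).
    by apply: per4_zeta_cvg; rewrite addn1 ltnS muln_gt0.
  apply/funext => N; apply: eq_bigr => n _.
  by rewrite /per4_quot addn1 exprS invfM mulrA.
have oz2 : (2 <= 2 * m + 1)%N by rewrite addn1 ltnS muln_gt0.
have hB : (fun N => \sum_(0 <= n < N | odd n) per4_quot n * n%:R ^- (2 * m)) @ \oo -->
   2 * odd_zeta (2 * m + 1).
  rewrite (_ : (fun N => _) = fun N =>
      2 * series (fun i => i.*2.+1%:R ^- (2 * m + 1)) (N - 0)./2).
    apply: cvgM; first exact: cvg_cst.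
    by apply: (cvg_subseq (@cvg_half 0)); exact: cvg_odd_zeta.
  apply/funext => N; rewrite sum_odd subn0 /series/= mulr_sumr; apply: eq_bigr => i _.
  by rewrite /per4_quot per4_odd addn1 exprS invfM mulrA.
have g0 : per4_quot 0 = 0 by rewrite /per4_quot per4_0 mul0r.
pose W i : R := i.*2.+1%:R ^- 2 * (2 * (Aint i.*2.+1 - Dint i.*2.+2)
  - (-1) ^+ i * (pi / 2) - ln 2 + 3 / (2 * i.*2.+1%:R)).
have hW i : (fun N => sqr_sum per4_quot N i.*2.+1) @ \oo --> W i.
  exact: sqr_sum_per4_cvg.
have h := parity_sum g0 hG hB hW.
have {}h := h (2 * (2 * (2 + 2 * (1 + pi / 2))) + 2).
have {}h : series (fun i => i.*2.+1%:R ^- (2 * M) * W i) @ \oo -->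
   \sum_(1 <= a < M.+1) odd_zeta (2 * a) * G (M.+1 - a)%N -
   (M%:R + 1 / 4) * (2 * odd_zeta (2 * m + 1)).
  apply: h => N i.
  have x0 : i.*2.+1%:R ^+ 2 != 0 :> R by rewrite expf_neq0// pnatr_eq0.
  have -> : i.*2.+1%:R ^- (2 * M) * sqr_sum per4_quot N i.*2.+1 =
      (i.*2.+1%:R ^+ 2 * sqr_sum per4_quot N i.*2.+1) * i.*2.+1%:R ^- (2 * M + 2) :> R.
    rewrite exprD invfM; move: (i.*2.+1%:R ^+ 2) x0 => a a0.
    by move: (i.*2.+1%:R ^- (2 * M)) (sqr_sum _ _ _) => b d; field.
  rewrite normrM ler_pM ?sqr_sum_per4_le//.
  rewrite ger0_norm ?invr_ge0 ?exprn_ge0// inv_odd_pow_le//.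
  by rewrite leq_addl.
have hbeta : series (fun i => (-1) ^+ i * i.*2.+1%:R ^- (2 * m) : R) @ \oo -->
    dirichlet_beta R (2 * m) by apply: beta_series; exact: double_ge2.
have hl : series (fun i => i.*2.+1%:R ^- (2 * m) : R) @ \oo --> odd_zeta (2 * m).
  by apply: cvg_odd_zeta; exact: double_ge2.
have hl1 : series (fun i => i.*2.+1%:R ^- (2 * m + 1) : R) @ \oo --> odd_zeta (2 * m + 1).
  exact: cvg_odd_zeta.
set S := \sum_(1 <= a < M.+1) _ in h.
have -> : S / 2 - m%:R * odd_zeta (2 * m + 1) + pi / 4 * dirichlet_beta R (2 * m)
   + ln 2 / 2 * odd_zeta (2 * m) =
  1 / 2 * (S - (M%:R + 1 / 4) * (2 * odd_zeta (2 * m + 1)))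
  + pi / 4 * dirichlet_beta R (2 * m) + ln 2 / 2 * odd_zeta (2 * m)
  - 3 / 4 * odd_zeta (2 * m + 1).
  by rewrite -[m%:R]/(M.+1%:R) -[M.+1%:R]natr1; field.
rewrite (_ : series _ = fun K =>
  1 / 2 * series (fun i => i.*2.+1%:R ^- (2 * M) * W i) K
  + pi / 4 * series (fun i => (-1) ^+ i * i.*2.+1%:R ^- (2 * m) : R) K
  + ln 2 / 2 * series (fun i => i.*2.+1%:R ^- (2 * m) : R) K
  - 3 / 4 * series (fun i => i.*2.+1%:R ^- (2 * m + 1) : R) K).
  apply: cvgB; last by apply: cvgM => //; exact: cvg_cst.
  apply: cvgD; last by apply: cvgM => //; exact: cvg_cst.
  by apply: cvgD; apply: cvgM => //; exact: cvg_cst.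
apply/funext => K; rewrite /series/= !mulr_sumr -!big_split -sumrB; apply: eq_bigr => i _.
rewrite /W /m mulnS /=.
have : i.*2.+1%:R != 0 :> R by rewrite pnatr_eq0.
move: (i.*2.+1%:R : R) => x x0.
have : x ^+ (2 * M) != 0 by rewrite expf_neq0.
rewrite (exprD x (2 + 2 * M) 1) (exprD x 2 (2 * M)) expr1.
by move: (x ^+ (2 * M)) => y y0; field; rewrite x0 y0.
Qed.

End evaluations.

Theorem corollary2 (R : realType) (m : nat) (hm : (1 <= m)%N) :
  (cvgn (multS_partial R m) /\
   multS R m =
     - (m%:R * (2 ^- (2 * m - 1)%N - 4) * riemann_zeta R (2 * m + 1))
     - 2 * (1 - 2 ^- (2 * m)) * ln 2 * riemann_zeta R (2 * m)
     - pi * dirichlet_beta R (2 * m)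
     - \sum_(1 <= a < m.+1) \sum_(1 <= b < m.+1 | (a + b)%N == m)
         2 * (1 - 2 ^- (2 * a)) * (4 ^- (2 * b) - 3 * 2 ^- (2 * b) + 2)
         * riemann_zeta R (2 * a) * riemann_zeta R (2 * b + 1))
  /\
  (cvgn (multT_partial R m) /\
   multT R m =
     - 2 * (2 * m + 1)%N%:R * dirichlet_beta R (2 * m + 2)
     + \sum_(1 <= a < m.+2) \sum_(1 <= b < m.+2 | (a + b)%N == m.+1)
         4 * (1 - 2 ^- (2 * a)) * riemann_zeta R (2 * a)
         * dirichlet_beta R (2 * b)).
Proof.
have m2 : (2 <= 2 * m)%N by exact: double_ge2.
(* S has base [altseq 1] and d = 2m - 1; T has base [altseq 0] and d = 2m. *)
split.
  have [k kE] : exists k, (2 * m).-1 = k.+1.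
    by exists (2 * m).-2; move: m2; case: (2 * m)%N => [|[]].
  have mE : (2 * m = k.+2)%N by rewrite -kE prednK// (leq_trans _ m2).
  have [_ sl] := @chain_altseq_cvg R 1 k isT.
  have tE : (fun i => i.*2.+1%:R ^- k.+2 * tailint 1 i.*2.+1 : R) =
      fun i => i.*2.+1%:R ^- (2 * m) * (Aint i.*2.+1 - Dint i.*2.+2).
    by apply/funext => i; rewrite mE /tailint uint_tD.
  rewrite tE (cvg_lim _ (tail_series (R := R) hm))// in sl.
  set L := (_ + _)%R in sl.
  have hS : multS_partial R m @ \oo --> - (2 * (2 * L)).
    rewrite (_ : multS_partial R m = fun N => - (2 * (2 ^+ k.+1 *
       \sum_(0 <= n < N) chain (altseq 1) k.+1 n / n%:R))); last first.
      by apply/funext => N; rewrite multS_partialE// kE.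
    by apply: cvgN; apply: cvgM => //; exact: cvg_cst.
  split; first by apply/cvg_ex; eexists; exact: hS.
  rewrite /multS (cvg_lim _ hS)// /L sum_antidiagonal.
  have -> : \sum_(1 <= a < m) 2 * (1 - 2 ^- (2 * a)) *
      (4 ^- (2 * (m - a)) - 3 * 2 ^- (2 * (m - a)) + 2) * riemann_zeta R (2 * a) *
      riemann_zeta R (2 * (m - a) + 1) =
    2 * \sum_(1 <= a < m) odd_zeta (2 * a) *
      ((4 ^- (2 * (m - a)) - 3 * 2 ^- (2 * (m - a)) + 2) * riemann_zeta R (2 * (m - a) + 1)).
    rewrite mulr_sumr; apply: eq_big_nat => a /andP[a1 _].
    rewrite odd_zetaE; last exact: double_ge2.
    by move: (2 ^- _) (_ + 2) (riemann_zeta _ _) (riemann_zeta _ _) => *; ring.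
  rewrite !odd_zetaE// ?addn1 ?(leq_trans m2)//.
  rewrite subn1 kE mE (exprS 2 k.+2) (exprS 2 k.+1).
  have : (2 : R) ^+ k.+1 != 0 by rewrite expf_neq0.
  move: (2 ^+ k.+1) (\sum_(1 <= a < m) _) => x S x0.
  by field.
have [k kE] : exists k, (2 * m)%N = k.+1.
  by exists (2 * m).-1; move: m2; case: (2 * m)%N.
have [_ sl] := @chain_altseq_cvg R 0 k isT.
have tE : (fun i => i.*2.+1%:R ^- k.+2 * tailint 0 i.*2.+1 : R) =
    fun i => i.*2.+1%:R ^- (2 * m).+1 * Dint i.*2.+1.
  by apply/funext => i; rewrite kE /tailint uint_0D.
rewrite tE (cvg_lim _ (Dint_series (R := R) hm))// in sl.
set L := (_ - _)%R in sl.
have hT : multT_partial R m @ \oo --> - (2 * (2 * L)).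
  rewrite (_ : multT_partial R m = fun N => - (2 * (2 ^+ k.+1 *
     \sum_(0 <= n < N) chain (altseq 0) k.+1 n / n%:R))); last first.
    by apply/funext => N; rewrite multT_partialE// kE.
  by apply: cvgN; apply: cvgM => //; exact: cvg_cst.
split; first by apply/cvg_ex; eexists; exact: hT.
rewrite /multT (cvg_lim _ hT)// /L sum_antidiagonal.
have -> : \sum_(1 <= a < m.+1) 4 * (1 - 2 ^- (2 * a)) * riemann_zeta R (2 * a) *
    dirichlet_beta R (2 * (m.+1 - a)) =
  4 * \sum_(1 <= a < m.+1) odd_zeta (2 * a) * dirichlet_beta R (2 * (m.+1 - a)).
  rewrite mulr_sumr; apply: eq_big_nat => a /andP[a1 _].
  rewrite odd_zetaE; last exact: double_ge2.
  by move: (2 ^- _) (riemann_zeta _ _) (dirichlet_beta _ _) => *; ring.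
rewrite mulnS [(2 + _)%N]addnC natrD natrM.
by move: (\sum_(1 <= a < m.+1) _) (dirichlet_beta _ _) => S b; field.
Qed.
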